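(* Let $\sigma>0$, let $X(n)=\{X_v(n): v\in V_n\}$ be the branching random walk on the binary tree with $n$ levels with centered Gaussian increments of variance $\sigma^2$, and let $c=\sqrt{2\log 2}\,\sigma$. Then $$ \lim_{n\to\infty}\frac{\max_{v\in V_n}X_v(n)-cn}{\log n}=-\frac{3}{2}\,\frac{\sigma^2}{c}\qquad\text{in probability.} $$
   Context: For each $n\ge 1$, $V_n$ denotes the set of the $2^n$ leaves of a rooted binary tree with $n$ generations (every non-leaf vertex has exactly two children, and every leaf is at distance $n$ from the root $\emptyset$). Let $\{Y_e\}$ be independent, identically distributed centered Gaussian random variables of variance $\sigma^2$ indexed by the edges $e$ of this tree. The branching random walk is the field $X(n)=\{X_v(n): v\in V_n\}$ defined by $$X_v(n)=\sum_{e:\ \emptyset\to v}Y_e,$$ where the sum is over the $n$ edges $e$ on the path from the root $\emptyset$ to the leaf $v$. Here $\log$ is the natural logarithm. *)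

(* Defs.v *)
From HB Require Import structures.
From mathcomp Require Import all_boot all_order all_algebra.
From mathcomp Require Import all_classical all_reals all_analysis.

Set Implicit Arguments.
Unset Strict Implicit.
Unset Printing Implicit Defensive.

Import Order.TTheory GRing.Theory Num.Theory.
Import numFieldNormedType.Exports.

Local Open Scope classical_set_scope.
Local Open Scope ring_scope.

(* A vertex at depth k of the binary tree is the word of length k recording
   the left/right turns from the root, so the ancestors of a vertex (itself
   included) are its prefixes. *)
Definition leaf (n : nat) : finType := n.-tuple bool.

(* An edge is represented by its endpoint farther from the root, which can be
   any vertex but the root. *)
Definition edge (n : nat) : finType := {e : n.-bseq bool | (0 < size e)%N}.

Definition on_path (n : nat) (v : leaf n) (e : edge n) : bool :=
  prefix (val e : seq bool) v.

(* The product rule is required for every finite subfamily of the finite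
   family X. *)
Definition mutually_independent d (T : measurableType d) (R : realType)
    (P : probability T R) (I : finType) (X : I -> {RV P >-> R}) : Prop :=
  forall (J : {set I}) (B : I -> set R), (forall i, measurable (B i)) ->
    P (\bigcap_(i in [set` J]) (X i @^-1` B i)) =
    (\prod_(i in J) P (X i @^-1` B i))%E.

(* The second argument of [normal_prob] is the standard deviation. *)
Definition iid_centered_gaussian d (T : measurableType d) (R : realType)
    (P : probability T R) (I : finType) (sigma : R)
    (X : I -> {RV P >-> R}) : Prop :=
  mutually_independent X /\
  (forall (i : I) (B : set R), measurable B ->
    distribution P (X i) B = normal_prob 0 sigma B).

Definition brw (T : Type) (R : realType) (n : nat) (Y : edge n -> T -> R)
    (v : leaf n) (t : T) : R :=
  \sum_(e | on_path v e) Y e t.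

(* The set of leaves is never empty, so seeding the maximum with the value at
   the leftmost leaf does not change it. *)
Definition brw_max (T : Type) (R : realType) (n : nat) (Y : edge n -> T -> R)
    (t : T) : R :=
  \big[Num.max/brw Y [tuple of nseq n false] t]_(v : leaf n) brw Y v t.

(* As the limit l is constant, the Z n may live on different probability
   spaces. *)
Definition cvg_in_probability (R : realType) (d : nat -> measure_display)
    (T : forall n, measurableType (d n)) (P : forall n, probability (T n) R)
    (Z : forall n, T n -> R) (l : R) : Prop :=
  forall eps : R, 0 < eps ->
    (fun n => P n [set t | eps < `|Z n t - l|]) @ \oo --> 0%E.

(* Main.v *)
Require Import Defs.
From HB Require Import structures.
From mathcomp Require Import all_boot all_order all_algebra.
From mathcomp Require Import all_classical all_reals all_analysis.
From mathcomp Require Import measurable_realfun.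
From mathcomp Require Import ring lra.
Set Implicit Arguments.
Unset Strict Implicit.
Unset Printing Implicit Defensive.
Import Order.TTheory GRing.Theory Num.Theory.
Import numFieldNormedType.Exports.
Local Open Scope classical_set_scope.
Local Open Scope ring_scope.

(** Write M for the maximum over n generations and u_n(x) for the probability
    that M > x. The two subtrees hanging below the root are independent copies
    of the tree with one generation less, so that
      u_(n+1) = 2 K u_n - (K u_n)^2,   u_0(x) = 1 if x < 0 and 0 otherwise,
    where K is the convolution with the law N(0, V), V = sigma^2, of one
    increment ([brw_max_law]; u_n is [max_tail sigma n]). What remains is
    deterministic: to locate, up to o(log n), the front of this discrete
    analogue of the KPP equation. This is done by comparison with
    explicit super- and subsolutions.

    Let theta > 0 be such that exp(theta^2 V / 2) = 2; then c = theta V and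
    sigma^2 / c = 1 / theta. If u_n(c n + y) = exp(- theta y) g_n(y), the linear
    part g_(n+1) = K g_n of the recursion is the heat equation in discrete time,
    and the method of images gives it the exact solution
      dheat a s z = s^(-1/2) (exp(-(z-a)^2 / 2Vs) - exp(-(z+a)^2 / 2Vs)),
    which is odd in z, hence vanishes at z = 0, and has size z s^(-3/2) for
    bounded z. Being kept on the half-line from near 0 to near 0 thus has weight
    n^(-3/2), and exp(- theta y) n^(-3/2) = 1 at y = -(3 / (2 theta)) log n, which
    is the logarithmic correction.

    Upper bound. Since u_n <= 1, also g_n(y) <= exp(theta y), which is negligible
    for y <= - A log n. So the mass may be absorbed there: a multiple of dheat
    plus a tiny error is a supersolution ([max_tail_le_dheat]). Evaluated at
    y = (eps - 3 / (2 theta)) log n it tends to 0 ([max_tail_upper]).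

    Lower bound, in three phases.
    - A small constant multiple of exp(- theta z) dheat 1 s z is a subsolution in
      the frame of speed c: exp(- theta z) dheat 1 s z is at most of order
      s^(-3/2), which is summable, so the quadratic term costs at most a factor
      2 ([max_tail_ge_iter]). This gives u_n(c n + 1) of order n^(-3/2).
    - The same subsolution with a fixed t < theta, in the frame of speed t V,
      gains a factor r = 2 exp(- t^2 V / 2) > 1 per generation. It is run for
      m = (3/2) log n / log r generations, which turns n^(-3/2) into a power of
      1 / log n and lowers the level, relative to speed c, by
      (theta - t) V m = (3 / (theta + t)) log n, which is close to
      (3 / (2 theta)) log n when t is close to theta
      ([max_tail_ge_two_speeds]).
    - In kappa log n more generations, each lowering the level by a constant, a
      probability of that size grows geometrically up to 1 - del
      ([max_tail_boost_iter]). As kappa is arbitrary, the level lost here is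
      o(log n), and [max_tail_lower] follows. *)

(** * Gaussian integrals *)

Section gaussian_integrals.
Context {R : realType} (sigma : R).
Hypothesis sigma_gt0 : 0 < sigma.
Local Notation gamma := (normal_prob 0 sigma).
Local Notation mu := (@lebesgue_measure R).

(** The Radon-Nikodym derivative of the normal law is almost everywhere its
    density, by uniqueness. *)
Lemma ge0_integral_normal (f : R -> \bar R) :
  measurable_fun setT f -> (forall x, 0 <= f x)%E ->
  (\int[gamma]_x f x = \int[mu]_x (f x * (normal_pdf 0 sigma x)%:E))%E.
Proof.
move=> mf f0; have numu := normal_prob_dominates 0 sigma.
rewrite -(@Radon_Nikodym_SigmaFinite.change_of_variables _ _ _ gamma mu numu f)//.
have iF := Radon_Nikodym_SigmaFinite.f_integrable numu.
apply: ae_eq_integral => //.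
- by apply: emeasurable_funM => //; exact: measurable_int iF.
- apply: emeasurable_funM => //; apply/measurable_EFinP.
  exact: measurable_normal_pdf.
- apply: ae_eqe_mul2l; apply: integral_ae_eq => //.
    by apply/measurable_EFinP; exact: measurable_normal_pdf.
  by move=> E _ mE; rewrite -Radon_Nikodym_SigmaFinite.f_integral.
Qed.

(** Both families of integrals needed below reduce to the fact that some Gaussian
    density has mass 1: the integrand times the density of the increment is
    itself a multiple of a Gaussian density. *)
Lemma gaussian_density_integral (f : R -> R) (m s C : R) :
  measurable_fun setT f -> (forall y, 0 <= f y) ->
  (forall y, f y * normal_pdf 0 sigma y = C * normal_pdf m s y) ->
  gamma.-integrable setT (EFin \o f) /\ \int[gamma]_y f y = C.
Proof.
move=> mf f0 fE.
have I : (\int[gamma]_y (f y)%:E = C%:E)%E.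
  rewrite ge0_integral_normal//; last exact/measurable_EFinP.
  under eq_integral do rewrite -EFinM fE EFinM.
  rewrite integralZl//; last exact: integrable_normal_pdf.
  by rewrite integral_normal_pdf mule1.
split; last by rewrite /Rintegral I.
apply/integrableP; split; first exact/measurable_EFinP.
under eq_integral do rewrite /= ger0_norm//.
by rewrite I ltry.
Qed.
End gaussian_integrals.

(** * Convolution with the Gaussian law of one increment *)

(** The product of two Gaussian factors in y and of an exponential tilt is, up to
    a factor free of y, Gaussian in y. *)
Lemma complete_square (F : realFieldType) (l v s b y : F) :
  v != 0 -> s != 0 -> s + 1 != 0 ->
  l * y - (b - y) ^+ 2 / (2 * v * s) - y ^+ 2 / (v * 2) =
  l ^+ 2 * v / 2 - (b - l * v) ^+ 2 / (2 * v * (s + 1))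
   - (y - (l * v * s + b) / (s + 1)) ^+ 2 / (v * (s / (s + 1)) * 2).
Proof. by move=> v0 s0 s1; field; rewrite v0 s0 s1. Qed.

Section gaussian_step.
Context {R : realType} (sigma : R).
Hypothesis sigma_gt0 : 0 < sigma.
Local Notation gamma := (normal_prob 0 sigma).
Local Notation V := (sigma ^+ 2).

Definition gconv (f : R -> R) (x : R) : R := \int[gamma]_y f (x - y).

Definition gconv_integrable (f : R -> R) :=
  forall x, gamma.-integrable setT (EFin \o (fun y => f (x - y))).

(** The Gaussian kernel of variance V s, without its factor 1 / sqrt (2 pi V),
    which would cancel everywhere. *)
Definition heat (s z : R) : R :=
  (Num.sqrt s)^-1 * expR (- z ^+ 2 / (2 * V * s)).

Lemma measurable_heat s : measurable_fun setT (heat s).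
Proof.
apply: measurable_funM => //; apply: measurableT_comp => //.
apply: measurable_funM => //; apply: measurableT_comp => //.
Qed.

Lemma heat_ge0 s z : 0 <= heat s z.
Proof. by rewrite mulr_ge0 ?invr_ge0 ?sqrtr_ge0 ?expR_ge0. Qed.

Lemma normal_peakM t : 0 < t -> normal_peak (sigma * t) = normal_peak sigma / t.
Proof.
move=> t0; rewrite /normal_peak -invfM exprMn -mulrnAr mulrAC sqrtrM; last first.
  by rewrite mulr_ge0 ?sqr_ge0// mulrn_wge0// pi_ge0.
by rewrite mulrnAr sqrtr_sqr gtr0_norm.
Qed.

Lemma gconv_exp l :
  gconv_integrable (fun x => expR (- l * x)) /\
  forall x, gconv (fun x => expR (- l * x)) x = expR (l ^+ 2 * V / 2 - l * x).
Proof.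
have s0 : sigma != 0 by rewrite gt_eqF.
suff H x : gamma.-integrable setT (EFin \o (fun y => expR (- l * (x - y)))) /\
    gconv (fun x => expR (- l * x)) x = expR (l ^+ 2 * V / 2 - l * x).
  by split => x; have [] := H x.
apply: (@gaussian_density_integral _ _ _ (l * V) sigma) => //.
- apply: measurableT_comp => //; apply: measurable_funM => //.
  exact: measurable_funB.
- move=> y; rewrite !normal_pdfE// mulrCA [RHS]mulrCA; congr (_ * _).
  rewrite /normal_fun -!expRD -mulr_natr; congr expR.
  by field.
Qed.

(** The semigroup property of the heat kernel under an exponential tilt: the tilt
    shifts the increment by l V, as in Girsanov's formula. *)
Lemma gconv_heat l a s : 0 < s ->
  gconv_integrable (fun x => expR (- l * x) * heat s (x - a)) /\
  forall x, gconv (fun x => expR (- l * x) * heat s (x - a)) x =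
    expR (l ^+ 2 * V / 2 - l * x) * heat (s + 1) (x - l * V - a).
Proof.
move=> s_gt0; have s0 : sigma != 0 by rewrite gt_eqF.
have s1_gt0 : 0 < s + 1 by rewrite addr_gt0.
pose t := Num.sqrt s / Num.sqrt (s + 1).
have t0 : 0 < t by rewrite divr_gt0// sqrtr_gt0.
have t2 : t ^+ 2 = s / (s + 1) by rewrite exprMn exprVn !sqr_sqrtr ?ltW.
suff H x : gamma.-integrable setT
      (EFin \o (fun y => expR (- l * (x - y)) * heat s (x - y - a))) /\
    gconv (fun x => expR (- l * x) * heat s (x - a)) x =
      expR (l ^+ 2 * V / 2 - l * x) * heat (s + 1) (x - l * V - a).
  by split => x; have [] := H x.
pose m := (l * V * s + x - a) / (s + 1).
apply: (@gaussian_density_integral _ _ _ m (sigma * t)) => //.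
- apply: measurable_funM => //.
    apply: measurableT_comp => //; apply: measurable_funM => //.
    exact: measurable_funB.
  apply: measurableT_comp; first exact: measurable_heat.
  by do 2 apply: measurable_funB => //.
- by move=> y; rewrite mulr_ge0 ?expR_ge0 ?heat_ge0.
- have st0 : sigma * t != 0 by rewrite gt_eqF// mulr_gt0.
  move=> y; rewrite !normal_pdfE// normal_peakM// /heat /normal_fun exprMn t2.
  have -> : expR (- l * (x - y)) *
      ((Num.sqrt s)^-1 * expR (- (x - y - a) ^+ 2 / (2 * V * s))) *
      (normal_peak sigma * expR (- (y - 0) ^+ 2 / (V *+ 2))) =
    normal_peak sigma / Num.sqrt s * expR (- l * (x - y)
      - (x - y - a) ^+ 2 / (2 * V * s) - (y - 0) ^+ 2 / (V *+ 2)).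
    by rewrite !expRD -!mulNr; ring.
  have -> : expR (l ^+ 2 * V / 2 - l * x) * ((Num.sqrt (s + 1))^-1 *
      expR (- (x - l * V - a) ^+ 2 / (2 * V * (s + 1)))) *
      (normal_peak sigma / t * expR (- (y - m) ^+ 2 / ((V * (s / (s + 1))) *+ 2)))
   = normal_peak sigma / Num.sqrt s * expR (l ^+ 2 * V / 2 - l * x
      - (x - l * V - a) ^+ 2 / (2 * V * (s + 1))
      - (y - m) ^+ 2 / ((V * (s / (s + 1))) *+ 2)).
    rewrite !expRD -!mulNr /t; set e1 := expR _; set e2 := expR _.
    field; by rewrite ?mulf_neq0 ?gt_eqF ?sqrtr_gt0.
  congr (_ * expR _); rewrite /m -(mulr_natr V) -(mulr_natr (V * _)) subr0.
  have -> : x - y - a = x - a - y by rewrite addrAC.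
  have -> : x - l * V - a = x - a - l * V by rewrite addrAC.
  have V0 : V != 0 by rewrite expf_neq0.
  have sn0 : s != 0 by rewrite gt_eqF.
  have sn1 : s + 1 != 0 by rewrite gt_eqF.
  have /(congr1 (fun t => - l * x + t)) := complete_square l (x - a) y V0 sn0 sn1.
  rewrite -addrA; set A1 := (_ ^+ 2 / _); set A2 := (_ ^+ 2 / _).
  set A3 := (_ ^+ 2 / _); set A4 := (_ ^+ 2 / _) => H.
  transitivity (- l * x + (l * y + (- A1 - A2))); first by ring.
  by rewrite H addrA /A4 addrA; ring.
Qed.

End gaussian_step.

Section gaussian_step_order.
Context {R : realType} (sigma : R).
Local Notation gamma := (normal_prob 0 sigma).
Local Notation gconv := (gconv sigma).
Local Notation gconv_integrable := (gconv_integrable sigma).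

Lemma le_gconv f g x : gconv_integrable f -> gconv_integrable g ->
  (forall z, f z <= g z) -> gconv f x <= gconv g x.
Proof. by move=> fi gi fg; apply: le_Rintegral. Qed.

Lemma gconv_integrableZ k f : gconv_integrable f ->
  gconv_integrable (fun x => k * f x).
Proof.
move=> fi x; have := integrableZl measurableT k (fi x).
by apply: eq_integrable.
Qed.

Lemma gconv_integrableD f g : gconv_integrable f -> gconv_integrable g ->
  gconv_integrable (fun x => f x + g x).
Proof.
move=> fi gi x; have := integrableD measurableT (fi x) (gi x).
by apply: eq_integrable.
Qed.

Lemma gconv_integrableB f g : gconv_integrable f -> gconv_integrable g ->
  gconv_integrable (fun x => f x - g x).
Proof.
move=> fi gi x; have := integrableB measurableT (fi x) (gi x).
by apply: eq_integrable.
Qed.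

Lemma gconvZ k f x : gconv_integrable f ->
  gconv (fun x => k * f x) x = k * gconv f x.
Proof. by move=> fi; rewrite /gconv RintegralZl. Qed.

Lemma gconvD f g x : gconv_integrable f -> gconv_integrable g ->
  gconv (fun x => f x + g x) x = gconv f x + gconv g x.
Proof. by move=> fi gi; rewrite /gconv RintegralD. Qed.

Lemma gconvB f g x : gconv_integrable f -> gconv_integrable g ->
  gconv (fun x => f x - g x) x = gconv f x - gconv g x.
Proof. by move=> fi gi; rewrite /gconv RintegralB. Qed.

Lemma gconv_shift f b x :
  gconv (fun z => f (b + z)) x = gconv f (b + x).
Proof. by apply: eq_Rintegral => y _; rewrite addrA. Qed.

Lemma gconv_integrable_shift f b : gconv_integrable f ->
  gconv_integrable (fun z => f (b + z)).
Proof.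
move=> fi x; have := fi (b + x).
by apply: eq_integrable => // y _ /=; rewrite addrA.
Qed.

Lemma gconv_cst k x : gconv (cst k) x = k.
Proof.
by rewrite /gconv Rintegral_cst// [X in fine X](@probability_setT _ _ _ gamma)/= mulr1.
Qed.

Lemma gconv_integrable_bounded (M : R) (f : R -> R) :
  measurable_fun setT f -> (forall x, `|f x| <= M) -> gconv_integrable f.
Proof.
move=> mf bf x; apply: measurable_bounded_integrable => //.
- by rewrite (le_lt_trans (probability_le1 _ _)) ?ltry.
- by apply: measurableT_comp => //; exact: measurable_funB.
- exists M; split; first exact: num_real.
  by move=> N MN y _ /=; rewrite (le_trans (bf _)) ?ltW.
Qed.

End gaussian_step_order.

Section tail_recursion.
Context {R : realType} (sigma : R).
Local Notation gconv := (gconv sigma).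
Local Notation gconv_integrable := (gconv_integrable sigma).

(** 1 - (1 - gconv f x) ^+ 2: one of two independent subtrees exceeds x, each of
    them being displaced by one Gaussian increment. *)
Definition branching_step (f : R -> R) (x : R) : R :=
  2 * gconv f x - (gconv f x) ^+ 2.

Definition max_tail (n : nat) : R -> R :=
  iter n branching_step (fun x => (x < 0)%R%:R).

(** The invariant of the recursion that makes all convolutions meaningful:
    monotonicity is what gives measurability. *)
Definition tail_like (f : R -> R) :=
  (forall x, 0 <= f x <= 1) /\ {homo f : x y /~ x <= y}.

Lemma tail_like_integrable f : tail_like f -> gconv_integrable f.
Proof.
move=> [f01 ni]; apply: (@gconv_integrable_bounded _ _ 1).
  by apply: nonincreasing_measurable => // y z; exact: ni.
by move=> x; have /andP[f0 f1] := f01 x; rewrite ger0_norm.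
Qed.

Lemma tail_like_gconv f : tail_like f -> tail_like (gconv f).
Proof.
move=> tf; have fi := tail_like_integrable tf; case: (tf) => f01 ni.
split => [x|x y xy].
  rewrite Rintegral_ge0 /=; last by move=> y _; case/andP: (f01 (x - y)).
  rewrite -[leRHS](gconv_cst sigma _ x) le_gconv//.
    by apply: (@gconv_integrable_bounded _ _ 1) => // y; rewrite normr1.
  by move=> z; case/andP: (f01 z).
have E z : gconv f z = gconv (fun t => f (t + (z - x))) x.
  by apply: eq_Rintegral => t _; congr f; ring.
rewrite (E y) (E x).
apply: le_gconv => [||z]; last by rewrite ni// !(lerD2l, lerD2r).
- apply: tail_like_integrable; split => [z|z t zt]; [exact: f01|].
  by rewrite ni// lerD2r.
- apply: tail_like_integrable; split => [z|z t zt]; [exact: f01|].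
  by rewrite ni// lerD2r.
Qed.

Lemma max_tail_tail_like n : tail_like (max_tail n).
Proof.
elim: n => [|n IH].
  split => [x|x y yx] /=; first by case: ltP; rewrite ?lexx ?ler01.
  rewrite ler_nat; case: (ltP x 0) => //= x0.
  by rewrite (le_lt_trans yx x0).
have [K01 Kni] := tail_like_gconv IH.
split => [x|x y yx]; rewrite /max_tail iterS -/(max_tail n) /branching_step.
  have /andP[] := K01 x; set t := gconv _ _ => t0 t1.
  by apply/andP; split; nra.
have := Kni _ _ yx; have /andP[] := K01 x; have /andP[] := K01 y.
by set t := gconv _ y; set s := gconv _ x => *; nra.
Qed.

Lemma max_tailS n x : max_tail n.+1 x =
  2 * gconv (max_tail n) x - (gconv (max_tail n) x) ^+ 2.
Proof. by []. Qed.

Lemma max_tail_integrable n : gconv_integrable (max_tail n).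
Proof. exact/tail_like_integrable/max_tail_tail_like. Qed.

Lemma max_tail_ge0 n x : 0 <= max_tail n x.
Proof. by have [/(_ x)/andP[]] := max_tail_tail_like n. Qed.

Lemma max_tail_le1 n x : max_tail n x <= 1.
Proof. by have [/(_ x)/andP[]] := max_tail_tail_like n. Qed.

Lemma max_tail_nonincreasing n : {homo max_tail n : x y /~ x <= y}.
Proof. by have [] := max_tail_tail_like n. Qed.

Lemma gconv_max_tail_ge0 n x : 0 <= gconv (max_tail n) x.
Proof. by have [/(_ x)/andP[]] := tail_like_gconv (max_tail_tail_like n). Qed.

Lemma gconv_max_tail_le1 n x : gconv (max_tail n) x <= 1.
Proof. by have [/(_ x)/andP[]] := tail_like_gconv (max_tail_tail_like n). Qed.

End tail_recursion.

(** * The heat kernel with an absorbing barrier *)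

Section dirichlet_heat_kernel.
Context {R : realType} (sigma : R).
Hypothesis sigma_gt0 : 0 < sigma.
Local Notation V := (sigma ^+ 2).
Local Notation heat := (heat sigma).

Let V_gt0 : 0 < V. Proof. exact: exprn_gt0. Qed.

(** The kernel on the half-line absorbed at 0, with source at a, by the method of
    images. It is kept, negative, on the other half-line: this makes it an exact
    solution on the whole line. *)
Definition dheat (a s z : R) : R := heat s (z - a) - heat s (z + a).

Lemma dheatE a s z : 0 < s ->
  dheat a s z = heat s (z - a) * (1 - expR (- (2 * a * z / (V * s)))).
Proof.
move=> s0; rewrite /dheat /heat mulrBr mulr1; congr (_ - _).
rewrite -[RHS]mulrA -expRD; congr (_ * expR _).
by field; rewrite ?mulf_neq0 ?gt_eqF.
Qed.

Lemma heat_le s z : 0 < s -> heat s z <= (Num.sqrt s)^-1.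
Proof.
move=> s0; rewrite ler_piMr ?invr_ge0 ?sqrtr_ge0// -[leRHS]expR0 ler_expR.
by rewrite mulNr oppr_le0 divr_ge0 ?sqr_ge0// !mulr_ge0// ltW.
Qed.

Lemma dheat_le0 a s z : 0 <= a -> 0 < s -> z <= 0 -> dheat a s z <= 0.
Proof.
move=> a0 s0 z0; rewrite dheatE// mulr_ge0_le0 ?heat_ge0// subr_le0.
rewrite -[leLHS]expR0 ler_expR oppr_ge0 mulr_le0_ge0 ?invr_ge0//; last first.
  by rewrite mulr_ge0 ?ltW.
by rewrite mulr_ge0_le0// mulr_ge0.
Qed.

Lemma dheat_ge0 a s z : 0 <= a -> 0 < s -> 0 <= z -> 0 <= dheat a s z.
Proof.
move=> a0 s0 z0; rewrite dheatE// mulr_ge0 ?heat_ge0// subr_ge0.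
rewrite -[leRHS]expR0 ler_expR oppr_le0 divr_ge0//.
  by rewrite !mulr_ge0.
by rewrite mulr_ge0 ?ltW.
Qed.

(** The linear vanishing at 0 supplies the extra factor z / s. *)
Lemma dheat_le a s z : 0 <= a -> 0 < s -> 0 <= z ->
  dheat a s z <= (Num.sqrt s)^-1 * (2 * a * z / (V * s)).
Proof.
move=> a0 s0 z0; rewrite dheatE//; apply: ler_pM => //.
- exact: heat_ge0.
- rewrite subr_ge0 -[leRHS]expR0 ler_expR oppr_le0 divr_ge0//.
    by rewrite !mulr_ge0.
  by rewrite mulr_ge0 ?ltW.
- exact: heat_le.
- have := expR_ge1Dx (- (2 * a * z / (V * s))); lra.
Qed.

Lemma dheat_geN1 a s z : 1 <= s -> -1 <= dheat a s z.
Proof.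
move=> s1; have s0 : 0 < s by rewrite (lt_le_trans ltr01).
rewrite /dheat lerBrDr (le_trans (y := 0))//; last exact: heat_ge0.
rewrite addrC subr_le0 (le_trans (heat_le _ _))// invf_le1 ?sqrtr_gt0//.
by rewrite -[leLHS]sqrtr1 ler_sqrt// ltW.
Qed.

(** In a frame moving at speed l V, where z stands for the position after the
    step, the tilted kernel is only aged by one unit and rescaled. *)
Lemma gconv_tilt_dheat l a s : 0 < s ->
  gconv_integrable sigma (fun z => expR (- l * z) * dheat a s z) /\
  forall z, gconv sigma (fun z => expR (- l * z) * dheat a s z) (z + l * V) =
    expR (- (l ^+ 2 * V / 2)) * (expR (- l * z) * dheat a (s + 1) z).
Proof.
move=> s0.
have [i1 e1] := gconv_heat sigma_gt0 l a s0.
have [i2 e2] := gconv_heat sigma_gt0 l (- a) s0.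
have E : (fun z => expR (- l * z) * dheat a s z) =
  (fun z => expR (- l * z) * heat s (z - a) - expR (- l * z) * heat s (z - - a)).
  by apply/funext => z; rewrite opprK -mulrBr.
rewrite E; split=> [|z]; first exact: gconv_integrableB.
rewrite gconvB// e1 e2 -mulrBr mulrA -expRD; congr (expR _ * _).
  by field.
by rewrite /dheat opprK addrK.
Qed.

Lemma gconv_tilt_exp t l :
  gconv_integrable sigma (fun z => expR (- (t + l) * z)) /\
  forall z, gconv sigma (fun z => expR (- (t + l) * z)) (z + t * V) =
    expR ((l ^+ 2 - t ^+ 2) * V / 2) * expR (- (t + l) * z).
Proof.
have [i e] := gconv_exp sigma_gt0 (t + l); split=> // z.
by rewrite e -expRD; congr expR; field.
Qed.

End dirichlet_heat_kernel.

(** * Upper bound: a supersolution *)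

(** Nonnegativity of products, sums, inverses, powers and exponentials. *)
Ltac nneg := repeat (first [done | by apply: ltW | apply: mulr_ge0
  | apply: addr_ge0 | rewrite invr_ge0 | apply: exprn_ge0 | apply: expR_ge0
  | apply: sqrtr_ge0 | apply: ler0n]).

Lemma expRN_le_inv (R : realType) (x : R) : 0 < x -> expR (- x) <= x^-1.
Proof.
move=> x0; rewrite expRN lef_pV2 ?posrE ?expR_gt0//.
by rewrite (le_trans _ (expR_ge1Dx x))// lerDr.
Qed.

Lemma exprX_expRN_le (R : realType) (k : nat) (c x : R) : 0 < c -> 0 < x ->
  x ^+ k * expR (- (c * x)) <= (k.+1%:R / c) ^+ k.+1 / x.
Proof.
move=> c0 x0; have k0 : 0 < k.+1%:R :> R by [].
have -> : - (c * x) = k.+1%:R * - (c * x / k.+1%:R).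
  by rewrite mulrN [k.+1%:R * _]mulrC divfK// gt_eqF.
rewrite expRM_natl; have H : expR (- (c * x / k.+1%:R)) <= k.+1%:R / c / x.
  apply: (le_trans (expRN_le_inv _)); first by rewrite divr_gt0// mulr_gt0.
  by rewrite invf_div invfM mulrA.
apply: (@le_trans _ _ (x ^+ k * (k.+1%:R / c / x) ^+ k.+1)).
  rewrite ler_wpM2l ?exprn_ge0 ?(ltW x0)//.
  by apply: lerXn2r; rewrite ?nnegrE ?expR_ge0// !divr_ge0 ?ltW.
rewrite exprMn exprVn [x ^+ k.+1]exprSr invfM mulrCA (mulrA (x ^+ k)).
by rewrite divff ?mul1r// expf_neq0 ?gt_eqF.
Qed.


Section upper_barrier.
Context {R : realType} (sigma theta : R).
Hypothesis sigma_gt0 : 0 < sigma.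
Local Notation V := (sigma ^+ 2).
Hypothesis theta_gt0 : 0 < theta.
Hypothesis theta_crit : expR (theta ^+ 2 * V / 2) = 2.
Local Notation max_tail := (max_tail sigma).
Local Notation gconv := (gconv sigma).
Local Notation dheat := (dheat sigma).

Let V_gt0 : 0 < V. Proof. exact: exprn_gt0. Qed.

Lemma max_tailS_le2 n x : max_tail n.+1 x <= 2 * gconv (max_tail n) x.
Proof. by rewrite max_tailS gerBl sqr_ge0. Qed.

(** The supersolution. In the coordinate z = y + L, the tilted tail is compared
    with C * dheat on z >= b, where b is a margin: a walk seen at z >= b reaches
    the region z < 0, where dheat is negative, only by a jump larger than b. The
    error delta per generation has two parts: on z < b the tail is at most 1,
    that is, at most exp (theta (b - L)) after tilting; and the negative part of
    dheat is seen only after a jump larger than b, which after tilting has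
    probability at most exp (- b ^+ 2 / 2V). *)
Lemma max_tail_le_dheat (a s b L C : R) (n : nat) :
  0 <= a -> 1 <= s -> 0 <= b -> 0 <= C ->
  (forall z, b <= z <= L -> 1 <= C * dheat a s z) ->
  let delta := expR (theta * (b - L)) + C * expR (- (b ^+ 2 / (2 * V))) in
  forall z, b <= z -> max_tail n (theta * V * n%:R - L + z) <=
    expR (theta * L) * expR (- theta * z) *
    (C * dheat a (s + n%:R) z + n%:R * delta).
Proof.
move=> a0 s1 b0 C0 base delta.
have delta0 : 0 <= delta by rewrite addr_ge0 ?mulr_ge0.
have s0 m : 0 < s + m%:R by rewrite ltr_wpDr// (lt_le_trans ltr01).
elim: n => [|n IH] z bz.
  rewrite mulr0 mul0r !addr0 add0r /=.
  have h0 : 0 <= C * dheat a s z.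
    by rewrite mulr_ge0// dheat_ge0// ?(le_trans b0)// -[s]addr0 (s0 0%N).
  have [zL|zL] := ltP; last by rewrite mulr_ge0// mulr_ge0.
  have Lz : z <= L by lra.
  rewrite -[leLHS]mulr1 ler_pM//; last by apply: base; rewrite bz.
  by rewrite -expRD -[leLHS]expR0 ler_expR mulNr subr_ge0 ler_wpM2l // ltW.
(* the tilt that is optimal for the Chernoff bound of a jump larger than b *)
pose lam := b / V.
have lam0 : 0 <= lam by rewrite divr_ge0// ltW.
pose D := theta * V * n%:R - L.
pose e := expR (theta * L).
have e0 : 0 <= e by exact: expR_ge0.
pose W w := e * C * (expR (- theta * w) * dheat a (s + n%:R) w)
  + e * (n%:R * delta + expR (theta * (b - L))) * expR (- (theta + 0) * w)
  + e * C * expR (- (theta + lam) * w).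
have fW w : max_tail n (D + w) <= W w.
  (* the three terms of W bound, after tilting, the tail on z >= b, the constant
     1 on z < b, and the negative part of dheat on z < 0 *)
  have EW : W w = e * expR (- theta * w) * (C * dheat a (s + n%:R) w + n%:R * delta)
     + e * expR (- theta * w) * expR (theta * (b - L))
     + e * C * expR (- theta * w) * expR (- lam * w).
    by rewrite /W addr0 opprD mulrDl expRD; ring.
  rewrite EW; have [bw|wb] := leP b w.
    rewrite -[leRHS]addrA; apply: (le_trans (IH w bw)); rewrite lerDl addr_ge0//.
      by rewrite !mulr_ge0.
    by rewrite !mulr_ge0.
  have H1 : 1 <= e * expR (- theta * w) * expR (theta * (b - L)).
    rewrite /e -!expRD -[leLHS]expR0 ler_expR.
    by have := mulr_ge0 (ltW theta_gt0) (ltW (etrans (subr_gt0 _ _) wb)); lra.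
  have H2 : 0 <= dheat a (s + n%:R) w + expR (- lam * w).
    have [w0|w0] := leP 0 w; first by rewrite addr_ge0// dheat_ge0.
    have h1 : -1 <= dheat a (s + n%:R) w by apply: dheat_geN1; rewrite ?ler_wpDr.
    have : 1 <= expR (- lam * w) by rewrite -[leLHS]expR0 ler_expR mulNr oppr_ge0 mulr_ge0_le0// ltW.
    lra.
  have H3 : 0 <= e * C * expR (- theta * w) *
      (dheat a (s + n%:R) w + expR (- lam * w)) by rewrite !mulr_ge0.
  have H4 : 0 <= e * expR (- theta * w) * (n%:R * delta) by rewrite !mulr_ge0.
  have := max_tail_le1 sigma n (D + w); lra.
have [hi hE] := gconv_tilt_dheat sigma_gt0 theta a (s0 n).
have [i0 E0] := gconv_tilt_exp sigma_gt0 theta 0.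
have [il El] := gconv_tilt_exp sigma_gt0 theta lam.
have iW1 := gconv_integrableZ (e * C) hi.
have iW2 := gconv_integrableZ (e * (n%:R * delta + expR (theta * (b - L)))) i0.
have iW3 := gconv_integrableZ (e * C) il.
have iW : gconv_integrable sigma W by do 2 apply: gconv_integrableD => //.
have half : expR (- (theta ^+ 2 * V / 2)) = 2^-1 by rewrite expRN theta_crit.
have -> : theta * V * n.+1%:R - L + z = D + (z + theta * V).
  by rewrite -natr1 /D; ring.
apply: (le_trans (max_tailS_le2 _ _)).
apply: (@le_trans _ _ (2 * gconv W (z + theta * V))).
  rewrite ler_pM2l// -(gconv_shift _ (max_tail n) D); apply: le_gconv => //.
  exact/gconv_integrable_shift/max_tail_integrable.
rewrite /W !gconvD//; last exact: gconv_integrableD.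
rewrite !gconvZ// hE E0 El half -/e.
have -> : s + n%:R + 1 = s + n.+1%:R by rewrite -natr1 addrA.
have -> : expR ((0 ^+ 2 - theta ^+ 2) * V / 2) = 2^-1.
  by rewrite -[RHS]half; congr expR; field.
have lz : expR ((lam ^+ 2 - theta ^+ 2) * V / 2) * expR (- (theta + lam) * z)
    <= expR (- (theta ^+ 2 * V / 2)) * expR (- theta * z) * expR (- (b ^+ 2 / (2 * V))).
  rewrite -!expRD ler_expR.
  have -> : (lam ^+ 2 - theta ^+ 2) * V / 2 + - (theta + lam) * z =
    - (theta ^+ 2 * V / 2) + - theta * z + (lam * (lam * V / 2) - lam * z) by field.
  rewrite lerD2l /lam divfK ?gt_eqF//.
  have -> : - (b ^+ 2 / (2 * V)) = b / V * (b / 2) - b / V * b by field; rewrite gt_eqF.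
  by rewrite lerD2l lerN2 ler_wpM2l.
rewrite addr0; rewrite half in lz.
have eC0 : 0 <= 2 * (e * C) by rewrite !mulr_ge0.
have := ler_wpM2l eC0 lz.
rewrite -(natr1 n) /delta; set E1 := expR (- theta * z); set H := dheat _ _ _.
lra.
Qed.
End upper_barrier.

Section upper_bound.
Context {R : realType} (sigma theta : R).
Hypothesis sigma_gt0 : 0 < sigma.
Local Notation V := (sigma ^+ 2).
Hypothesis theta_gt0 : 0 < theta.
Hypothesis theta_crit : expR (theta ^+ 2 * V / 2) = 2.
Local Notation max_tail := (max_tail sigma).
Local Notation dheat := (dheat sigma).

Let V_gt0 : 0 < V. Proof. exact: exprn_gt0. Qed.

(** With source at L and age of order L^2 the kernel is of order 1 / L on the
    whole of [L / A, L]; this dominates the initial condition at logarithmic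
    cost. *)
Lemma dheat_ge L z A : 0 < A -> 0 < L -> L / A <= z <= L ->
  L^-1 * (expR (- (2 * V)^-1) * (1 - expR (- (2 / (V * A))))) <=
    dheat L (L ^+ 2) z.
Proof.
move=> A0 L0 /andP[Lz zL]; have z0 : 0 < z by rewrite (lt_le_trans _ Lz)// divr_gt0.
rewrite dheatE ?exprn_gt0// /heat sqrtr_sqr gtr0_norm// -[leRHS]mulrA.
rewrite ler_pM2l ?invr_gt0//; apply: ler_pM => //.
- by rewrite subr_ge0 -[leRHS]expR0 ler_expR oppr_le0 divr_ge0// mulr_ge0// ltW.
- rewrite ler_expR mulNr lerN2 ler_pdivrMr ?mulr_gt0 ?exprn_gt0//.
  rewrite mulrA mulVf ?gt_eqF ?mulr_gt0// mul1r -[leLHS]sqrrN opprB.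
  by apply: lerXn2r; rewrite ?nnegrE ?subr_ge0 ?(ltW L0)//; lra.
- rewrite lerD2l lerN2 ler_expR lerN2.
  have -> : 2 * L * z / (V * L ^+ 2) = 2 / V * (z / L) by field; rewrite ?gt_eqF.
  rewrite invfM mulrA ler_wpM2l ?divr_ge0 ?(ltW V_gt0)//.
  by rewrite ler_pdivlMr// mulrC.
Qed.

(** With t = log n, the barrier is put at - A t with A = 1 + 3 / theta, so that the
    absorbed mass n * exp (theta (t - A t)) stays below the target n^(-3/2). All
    other factors are powers of t, beaten by exp (- theta eps t). *)
Lemma max_tail_upper (eps : R) : 0 < eps -> exists K : R, forall n : nat,
  K <= ln n%:R ->
  max_tail n (theta * V * n%:R + (eps - 3 / (2 * theta)) * ln n%:R) <= K / ln n%:R.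
Proof.
move=> eps0.
pose A := 1 + 3 / theta.
have A1 : 1 < A by rewrite ltrDl divr_gt0.
have A0 : 0 < A by rewrite (lt_trans ltr01).
pose k := (expR (- (2 * V)^-1) * (1 - expR (- (2 / (V * A)))))^-1.
have k0 : 0 < k.
  rewrite invr_gt0 mulr_gt0 ?expR_gt0// subr_gt0 -[ltRHS]expR0 ltr_expR oppr_lt0.
  by rewrite divr_gt0// mulr_gt0.
pose B := A + eps.
have B0 : 0 < B by rewrite addr_gt0.
pose K1 := k * A * (2 * A * B / V).
have K10 : 0 <= K1 by rewrite /K1; nneg.
pose K2 := k * A.
have K20 : 0 <= K2 by rewrite /K2; nneg.
pose M := K1 * (4%:R / (theta * eps)) ^+ 4 + 2 + K2 * 4.
have M0 : 0 <= M.
  by rewrite /M; nneg.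
exists (M + 7 * V + 1) => n.
set t := ln n%:R => tK.
have t1 : 1 <= t by have := mulr_ge0 (ler0n R 7) (ltW V_gt0); lra.
have t0 : 0 < t by rewrite (lt_le_trans ltr01).
have n0 : 0 < n%:R :> R.
  by rewrite ltNge; apply/negP => n0; move: t0; rewrite /t ln0// ltxx.
have nE : n%:R = expR t by rewrite lnK.
pose L := A * t; pose z := L + (eps - 3 / (2 * theta)) * t.
have L0 : 0 < L by rewrite mulr_gt0.
have L1 : 1 <= L by rewrite -[leLHS]mulr1 ler_pM// ltW.
have z_ge : t <= z.
  rewrite /z /L /A -mulrDl -[leLHS]mul1r ler_wpM2r ?(ltW t0)//.
  have -> : 3 / theta = 2 * (3 / (2 * theta)) by field; rewrite gt_eqF.
  have : 0 < 3 / (2 * theta) by rewrite divr_gt0// mulr_gt0.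
  lra.
have z_le : z <= B * t.
  rewrite /z /L -mulrDl ler_wpM2r ?(ltW t0)// /B addrA gerBl.
  by rewrite divr_ge0// mulr_ge0// ltW.
have z0 : 0 <= z by rewrite (le_trans (ltW t0)).
have base y : t <= y <= L -> 1 <= k * L * dheat L (L ^+ 2) y.
  move=> /andP[ty yL].
  have := @dheat_ge L y A A0 L0.
  rewrite /L mulrAC divff ?gt_eqF// mul1r ty yL => /(_ isT).
  rewrite -/L -(ler_pM2l (mulr_gt0 k0 L0)) => /(le_trans _); apply.
  by rewrite mulrA mulfK ?gt_eqF// /k mulVf ?gt_eqF// -invr_gt0.
have s1 : 1 <= L ^+ 2 by rewrite exprn_ege1.
have kL0 : 0 <= k * L by rewrite mulr_ge0 ?ltW.
have := max_tail_le_dheat sigma_gt0 theta_gt0 theta_crit n (ltW L0) s1 (ltW t0) kL0 base z_ge.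
have -> : theta * V * n%:R - L + z = theta * V * n%:R + (eps - 3 / (2 * theta)) * t.
  by rewrite /z; ring.
move=> /le_trans; apply.
have eE : expR (theta * L) * expR (- theta * z) =
    expR (- (theta * eps * t)) * expR (3 / 2 * t).
  by rewrite -!expRD /z; congr expR; field; rewrite gt_eqF.
have T1 : expR (3 / 2 * t) * (k * L * dheat L (L ^+ 2 + n%:R) z) <= K1 * t ^+ 3.
  have sn0 : 0 < L ^+ 2 + n%:R by rewrite addr_gt0// exprn_gt0.
  have h1 : dheat L (L ^+ 2 + n%:R) z <= expR (- (3 / 2 * t)) * (2 * L * z / V).
    apply: (le_trans (dheat_le sigma_gt0 (ltW L0) sn0 z0)).
    have -> : expR (- (3 / 2 * t)) * (2 * L * z / V) =
        (Num.sqrt n%:R)^-1 * (2 * L * z / (V * n%:R)).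
      have -> : - (3 / 2 * t) = - (t / 2) - t by field.
      have -> : Num.sqrt n%:R = expR (t / 2).
        rewrite nE [in LHS](splitr t) expRD -expr2 sqrtr_sqr gtr0_norm ?expR_gt0//.
      rewrite expRD (expRN t) -nE expRN; field.
      by rewrite ?gt_eqF ?expR_gt0.
    apply: ler_pM.
    - by rewrite invr_ge0 sqrtr_ge0.
    - by nneg.
    - rewrite lef_pV2 ?posrE ?sqrtr_gt0// ler_sqrt ?(ltW sn0)//.
      by rewrite lerDr exprn_ge0 ?ltW.
    - apply: ler_wpM2l; [by nneg|rewrite lef_pV2 ?posrE ?mulr_gt0//].
      by rewrite ler_wpM2l ?(ltW V_gt0)// lerDr exprn_ge0 ?ltW.
  apply: (@le_trans _ _ (k * L * (2 * L * z / V))).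
    rewrite mulrCA; apply: ler_wpM2l => //.
    have := ler_wpM2l (expR_ge0 (3 / 2 * t)) h1.
    by rewrite [X in _ <= X -> _]mulrA expRxMexpNx_1 mul1r.
  have -> : K1 * t ^+ 3 = k * L * (2 * L * (B * t) / V).
    by rewrite /K1 /L; ring.
  apply: ler_wpM2l => //; apply: ler_wpM2r; first by nneg.
  by apply: ler_wpM2l => //; nneg.
have T2 : expR (3 / 2 * t) * (n%:R * (expR (theta * (t - L)) +
    k * L * expR (- (t ^+ 2 / (2 * V))))) <= expR (- (1 / 2 * t)) + K2 * (t * expR (- t)).
  rewrite mulrA nE -expRD mulrDr lerD//.
    rewrite -expRD ler_expR /L /A.
    have -> : theta * (t - (1 + 3 / theta) * t) = - (3 * t) by field; rewrite gt_eqF.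
    lra.
  rewrite /L /K2 -!mulrA mulrCA ler_pM2l// mulrCA ler_pM2l// mulrCA ler_pM2l//.
  rewrite -expRD ler_expR.
  have h : 7 / 2 <= t / (2 * V).
    by rewrite ler_pdivlMr ?mulr_gt0//; have := ltW V_gt0; lra.
  have := ler_wpM2l (ltW t0) h; lra.
rewrite eE -mulrA mulrDr.
apply: (@le_trans _ _ (expR (- (theta * eps * t)) * (K1 * t ^+ 3) +
    (expR (- (1 / 2 * t)) + K2 * (t * expR (- t))))).
  rewrite mulrDr lerD//; first by rewrite ler_wpM2l.
  apply: (le_trans _ T2); rewrite ler_piMl//.
    by rewrite !mulr_ge0// addr_ge0// mulr_ge0.
  by rewrite -[leRHS]expR0 ler_expR oppr_le0 !mulr_ge0 ?ltW.
have d1 := exprX_expRN_le 3 (mulr_gt0 theta_gt0 eps0) t0.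
have d2 := exprX_expRN_le 0 (divr_gt0 ltr01 (ltr0n R 2)) t0.
have d3 := exprX_expRN_le 1 (@ltr01 R) t0.
rewrite mulrCA; apply: (@le_trans _ _ (M / t)).
  rewrite /M mulrDl mulrDl -addrA; apply: lerD.
    by rewrite -[leRHS]mulrA; apply: ler_wpM2l => //; rewrite mulrC.
  apply: lerD.
    have e2 : 1%:R / (1 / 2) = 2 :> R by field.
    by move: d2; rewrite expr0 mul1r expr1 e2.
  rewrite -[leRHS]mulrA; apply: ler_wpM2l => //.
  by move: d3; rewrite mul1r expr1 divr1 -natrX.
rewrite ler_wpM2r ?invr_ge0 ?(ltW t0)//.
by have := mulr_ge0 (ler0n R 7) (ltW V_gt0); lra.
Qed.
End upper_bound.

(** * Lower bound: a subsolution *)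

Section lower_barrier.
Context {R : realType} (sigma : R).
Hypothesis sigma_gt0 : 0 < sigma.
Local Notation V := (sigma ^+ 2).
Local Notation max_tail := (max_tail sigma).
Local Notation gconv := (gconv sigma).
Local Notation dheat := (dheat sigma).
Local Notation heat := (heat sigma).

Let V_gt0 : 0 < V. Proof. exact: exprn_gt0. Qed.

Lemma mulr_expRN_le (t z : R) : 0 < t -> z * expR (- t * z) <= t^-1.
Proof.
move=> t0; rewrite mulNr expRN ler_pdivrMr ?expR_gt0// mulrC ler_pdivlMr//.
by rewrite mulrC (le_trans _ (expR_ge1Dx _))// lerDr.
Qed.

(** The relative loss caused in one generation by the quadratic term, for the
    subsolution q * expR (- t z) * dheat 1 s z; the factor s^(-3/2) makes the
    losses summable. *)
Definition loss (t r q s : R) := q * r / (2 * V * t) / (s * Num.sqrt s).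

(** Because dheat is negative on z < 0, the hypothesis on all of the line costs
    nothing there, and the convolution of the subsolution is computed exactly,
    with no boundary term. *)
Lemma max_tail_ge_step (t q s x : R) (n : nat) :
  0 < t -> 0 <= q -> 0 < s ->
  let r := 2 * expR (- (t ^+ 2 * V / 2)) in
  (forall z, q * expR (- t * z) * dheat 1 s z <= max_tail n (x + z)) ->
  forall z, 0 <= z ->
  q * r * (1 - loss t r q (s + 1)) * expR (- t * z) * dheat 1 (s + 1) z
    <= max_tail n.+1 (x + t * V + z).
Proof.
move=> t0 q0 s0 r qle z z0.
have s10 : 0 < s + 1 by rewrite addr_gt0.
have r0 : 0 <= r by rewrite /r; nneg.
have [ih eh] := gconv_tilt_dheat sigma_gt0 t 1 s0.
pose T := q * (r / 2) * (expR (- t * z) * dheat 1 (s + 1) z).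
have h0 : 0 <= dheat 1 (s + 1) z by rewrite dheat_ge0.
have T0 : 0 <= T by rewrite /T; nneg.
have TK : T <= gconv (max_tail n) (x + t * V + z).
  have -> : T = gconv (fun z => q * (expR (- t * z) * dheat 1 s z)) (z + t * V).
    by rewrite gconvZ// eh /T /r; field.
  have -> : x + t * V + z = x + (z + t * V) by ring.
  rewrite -(gconv_shift _ (max_tail n) x); apply: le_gconv.
  - exact: gconv_integrableZ.
  - exact/gconv_integrable_shift/max_tail_integrable.
  - by move=> w; rewrite mulrA.
have K1 := gconv_max_tail_le1 sigma n (x + t * V + z).
rewrite max_tailS.
have Tl : T / 2 <= loss t r q (s + 1).
  have -> : T / 2 = q * r / 4 * (expR (- t * z) * dheat 1 (s + 1) z).
    by rewrite /T; field.
  have -> : loss t r q (s + 1) =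
      q * r / 4 * ((Num.sqrt (s + 1))^-1 * (2 * 1 / (V * (s + 1))) * t^-1).
    by rewrite /loss; field; rewrite ?gt_eqF// ?sqrtr_gt0.
  apply: ler_wpM2l; first by nneg.
  apply: (@le_trans _ _ (expR (- t * z) *
      ((Num.sqrt (s + 1))^-1 * (2 * 1 * z / (V * (s + 1)))))).
    by apply: ler_wpM2l => //; apply: dheat_le.
  have -> : expR (- t * z) * ((Num.sqrt (s + 1))^-1 * (2 * 1 * z / (V * (s + 1))))
     = (Num.sqrt (s + 1))^-1 * (2 * 1 / (V * (s + 1))) * (z * expR (- t * z)) by ring.
  apply: ler_wpM2l; first by nneg.
  exact: mulr_expRN_le.
set K := gconv _ _ in TK K1 *.
apply: (@le_trans _ _ (2 * T - T ^+ 2)); last by nra.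
have -> : q * r * (1 - loss t r q (s + 1)) * expR (- t * z) * dheat 1 (s + 1) z =
  2 * T * (1 - loss t r q (s + 1)) by rewrite /T; field.
have -> : 2 * T - T ^+ 2 = 2 * T * (1 - T / 2) by field.
by apply: ler_wpM2l; [rewrite mulr_ge0|rewrite lerD2l lerN2].
Qed.

(** Comparison of s^(-3/2) with a telescoping difference. *)
Lemma inv_sqrt3_le (s : R) : 0 < s ->
  ((s + 1) * Num.sqrt (s + 1))^-1 <= 2 * ((Num.sqrt s)^-1 - (Num.sqrt (s + 1))^-1).
Proof.
move=> s0; have s10 : 0 < s + 1 by rewrite addr_gt0.
have p0 : 0 < Num.sqrt s by rewrite sqrtr_gt0.
have w0 : 0 < Num.sqrt (s + 1) by rewrite sqrtr_gt0.
have p2 : Num.sqrt s ^+ 2 = s by rewrite sqr_sqrtr// ltW.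
have w2 : Num.sqrt (s + 1) ^+ 2 = s + 1 by rewrite sqr_sqrtr// ltW.
move: p0 w0 p2 w2; set p := Num.sqrt s; set w := Num.sqrt (s + 1) => p0 w0 p2 w2.
rewrite -w2; have H : w ^+ 2 - p ^+ 2 = 1 by rewrite p2 w2; ring.
have wp : p < w by rewrite -(@ltr_pXn2r _ 2) ?nnegrE ?ltW// p2 w2 ltrDl.
have -> : 2 * (p^-1 - w^-1) = 2 * w ^+ 2 * (w - p) / p * (w ^+ 2 * w)^-1.
  by field; rewrite ?gt_eqF.
rewrite -[leLHS]mul1r; apply: ler_wpM2r; first by nneg.
rewrite ler_pdivlMr// mul1r.
have : 0 <= w * (w - p) by rewrite mulr_ge0 ?subr_ge0 ?ltW.
have : 0 <= p * (w - p) by rewrite mulr_ge0 ?subr_ge0 ?ltW.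
have : 0 <= w * w * (w - p) by rewrite !mulr_ge0 ?subr_ge0 ?ltW.
have -> : 2 * w ^+ 2 * (w - p) = w * w * (w - p) + w * (w * (w - p)) by ring.
have : (w - p) * (w + p) = 1 by rewrite -H; ring.
nra.
Qed.

(** Starting from a small enough amplitude, the product of the factors 1 - loss
    stays above 1/2, and the subsolution grows like r ^+ J. *)
Lemma max_tail_ge_iter (t q s x : R) (n J : nat) :
  0 < t -> 0 <= q -> 0 < s ->
  let r := 2 * expR (- (t ^+ 2 * V / 2)) in
  1 <= r -> 2 * (q * r ^+ J) <= V * t * Num.sqrt s ->
  (forall z, q * expR (- t * z) * dheat 1 s z <= max_tail n (x + z)) ->
  forall z, 2^-1 * (q * r ^+ J) * expR (- t * z) * dheat 1 (s + J%:R) z <=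
    max_tail (n + J) (x + t * V * J%:R + z).
Proof.
move=> t0 q0 s0 r r1 small base.
have r0 : 0 <= r by rewrite (le_trans ler01).
have sj j : 0 < s + j%:R by rewrite ltr_wpDr.
have sq0 j : 0 < Num.sqrt (s + j%:R) by rewrite sqrtr_gt0.
have ss0 : 0 < Num.sqrt s by rewrite sqrtr_gt0.
pose c := q * r ^+ J / (2 * V * t).
have c0 : 0 <= c by rewrite /c; nneg; exact: ltW.
pose rho j := 1 - c * (2 * ((Num.sqrt s)^-1 - (Num.sqrt (s + j%:R))^-1)).
have cs : c * (2 * (Num.sqrt s)^-1) <= 2^-1.
  have -> : c * (2 * (Num.sqrt s)^-1) = q * r ^+ J / (V * t * Num.sqrt s).
    by rewrite /c; field; rewrite ?gt_eqF.
  rewrite ler_pdivrMr ?mulr_gt0//; lra.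
have rho_half j : 2^-1 <= rho j.
  have : 0 <= c * (2 * (Num.sqrt (s + j%:R))^-1) by nneg.
  by rewrite /rho; lra.
have rho1 j : rho j <= 1.
  rewrite /rho gerBl; apply: mulr_ge0 => //; apply: mulr_ge0 => //.
  by rewrite subr_ge0 lef_pV2 ?posrE// ler_sqrt ?(ltW (sj j))// lerDl.
suff H j : (j <= J)%N -> forall z,
    q * r ^+ j * rho j * expR (- t * z) * dheat 1 (s + j%:R) z <=
    max_tail (n + j) (x + t * V * j%:R + z).
  move=> z; have [z0|/ltW z0] := leP 0 z.
    apply: le_trans (H J (leqnn _) z).
    apply: ler_wpM2r; first exact: dheat_ge0.
    apply: ler_wpM2r => //.
    by rewrite [leRHS]mulrC; apply: ler_wpM2r => //; nneg.
  apply: (@le_trans _ _ 0); last exact: max_tail_ge0.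
  by rewrite mulr_ge0_le0 ?dheat_le0//; nneg.
elim: j => [_ z|j IH jJ z].
  rewrite /rho addr0 subrr !mulr0 subr0 expr0 !mulr1 !addr0 addn0; exact: base.
have rho0 i : 0 <= rho i by rewrite (le_trans _ (rho_half i)).
have [z0|/ltW z0] := leP 0 z; last first.
  apply: (@le_trans _ _ 0); last exact: max_tail_ge0.
  by rewrite mulr_ge0_le0 ?dheat_le0//; nneg.
have qj0 : 0 <= q * r ^+ j * rho j by nneg.
have := max_tail_ge_step t0 qj0 (sj j) (IH (ltnW jJ)) z0.
rewrite -/r.
have -> : s + j%:R + 1 = s + j.+1%:R by rewrite -(natr1 j) addrA.
have -> : x + t * V * j%:R + t * V + z = x + t * V * j.+1%:R + z.
  by rewrite -(natr1 j); ring.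
rewrite addnS; apply: le_trans.
apply: ler_wpM2r; first exact: dheat_ge0.
apply: ler_wpM2r => //.
rewrite -mulrA [X in _ <= X](_ : _ =
   q * r ^+ j.+1 * (rho j * (1 - loss t r (q * r ^+ j * rho j) (s + j.+1%:R)))); last first.
  by rewrite exprS; ring.
rewrite mulrA; apply: ler_wpM2l; first by nneg.
have ll : loss t r (q * r ^+ j * rho j) (s + j.+1%:R) <=
   c * (2 * ((Num.sqrt (s + j%:R))^-1 - (Num.sqrt (s + j.+1%:R))^-1)).
  rewrite /loss /c.
  have := inv_sqrt3_le (sj j).
  have -> : s + j%:R + 1 = s + j.+1%:R by rewrite -(natr1 j) addrA.
  move=> h; apply: ler_pM => //.
  - by nneg; exact: ltW.
  - by nneg; exact: ltW.
  - apply: ler_wpM2r; first by nneg; exact: ltW.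
    rewrite -!mulrA; apply: ler_wpM2l => //.
    apply: (@le_trans _ _ (r ^+ j * r)).
      apply: ler_wpM2l; first by nneg.
      by rewrite -[leRHS]mul1r; apply: ler_wpM2r.
    by rewrite -exprSr; apply: ler_weXn2l.
have l0 : 0 <= loss t r (q * r ^+ j * rho j) (s + j.+1%:R).
  by rewrite /loss; nneg; exact: ltW.
move: (rho1 j) (rho0 j) ll l0; rewrite /rho.
set l := loss _ _ _ _; set A1 := (Num.sqrt s)^-1; set A2 := (Num.sqrt (s + j%:R))^-1.
set A3 := (Num.sqrt _)^-1; set Y := c * (2 * (A1 - A2)) => h1 h2 h3 h4.
have -> : c * (2 * (A1 - A3)) = Y + c * (2 * (A2 - A3)) by rewrite /Y; ring.
nra.
Qed.
End lower_barrier.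

Section lower_bound_start.
Context {R : realType} (sigma theta : R).
Hypothesis sigma_gt0 : 0 < sigma.
Local Notation V := (sigma ^+ 2).
Hypothesis theta_gt0 : 0 < theta.
Hypothesis theta_crit : expR (theta ^+ 2 * V / 2) = 2.
Local Notation max_tail := (max_tail sigma).
Local Notation gconv := (gconv sigma).
Local Notation dheat := (dheat sigma).
Local Notation gamma := (normal_prob 0 sigma).

Let V_gt0 : 0 < V. Proof. exact: exprn_gt0. Qed.

Lemma gconv_max_tail_le n x : gconv (max_tail n) x <= max_tail n.+1 x.
Proof.
have := gconv_max_tail_ge0 sigma n x; have := gconv_max_tail_le1 sigma n x.
rewrite max_tailS; nra.
Qed.

Lemma normal_prob_ge_pdf (x : R) : 0 <= x ->
  ((normal_pdf 0 sigma (x + 1))%:E <= gamma `]x, (x + 1)%R]%classic)%E.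
Proof.
move=> x0; rewrite /normal_prob.
apply: (@le_trans _ _ (\int[lebesgue_measure]_(y in `]x, (x + 1)%R])
    (normal_pdf 0 sigma (x + 1))%:E)%E).
  rewrite integral_cst//= lebesgue_measure_itv/= lte_fin ltrDl ltr01.
  by rewrite -EFinB addrAC subrr add0r mule1.
apply: ge0_le_integral => //.
- by move=> y _; rewrite lee_fin normal_pdf_ge0.
- by apply/measurable_EFinP/measurable_funTS; exact: measurable_normal_pdf.
- move=> y /=; rewrite in_itv /= => /andP[xy yx].
  rewrite lee_fin !normal_pdfE ?gt_eqF//; apply: ler_wpM2l.
    exact: normal_peak_ge0.
  rewrite /normal_fun ler_expR !subr0 !mulNr lerN2; apply: ler_wpM2r.
    by rewrite invr_ge0 mulrn_wge0// sqr_ge0.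
  by apply: lerXn2r; rewrite ?nnegrE//; lra.
Qed.

Lemma max_tail1_ge_pdf (x : R) : 0 <= x ->
  normal_pdf 0 sigma (x + 1) <= max_tail 1 x.
Proof.
move=> x0; apply: le_trans (gconv_max_tail_le 0 x).
have -> : gconv (max_tail 0) x = fine (gamma `]x, +oo[%classic).
  have -> : gamma `]x, +oo[%classic =
      (\int[gamma]_y (\1_`]x, +oo[%classic y)%:E)%E by rewrite integral_indic// setIT.
  congr fine.
  apply: eq_integral => y _; rewrite indicE mem_setE in_itv /= andbT.
  by rewrite /max_tail /= subr_lt0.
rewrite -lee_fin fineK; last first.
  by rewrite fin_num_measure.
apply: (le_trans (normal_prob_ge_pdf x0)); apply: le_measure; rewrite ?inE//.
by move=> y /=; rewrite !in_itv /= => /andP[-> _].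
Qed.

(** A kernel of age 1/2 is narrower than the law of one increment, so that it lies
    below the tail of the first generation for all z at once. *)
Lemma max_tail1_ge : exists2 q : R, 0 < q & forall z,
  q * expR (- theta * z) * dheat 1 2^-1 z <= max_tail 1 z.
Proof.
pose p := normal_peak sigma; have p0 : 0 < p by rewrite normal_peak_gt0 ?gt_eqF.
pose w := (Num.sqrt (2^-1 : R))^-1.
have w0 : 0 < w by rewrite invr_gt0 sqrtr_gt0.
(* 4 / V is the maximum over z of (z + 1)^2 / 2V - (z - 1)^2 / V, attained at
   z = 3 *)
exists (p / w * expR (- (4 / V))); first by rewrite mulr_gt0 ?expR_gt0// divr_gt0.
move=> z; have [z0|/ltW z0] := leP 0 z; last first.
  apply: (@le_trans _ _ 0); last exact: max_tail_ge0.
  by rewrite mulr_ge0_le0 ?dheat_le0//; nneg.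
apply: le_trans (max_tail1_ge_pdf z0).
have h : dheat 1 2^-1 z <= w * expR (- ((z - 1) ^+ 2 / V)).
  rewrite /dheat; apply: (@le_trans _ _ (heat sigma 2^-1 (z - 1))).
    by rewrite gerBl heat_ge0.
  by rewrite /heat mulrAC divff// mul1r mulNr.
apply: (@le_trans _ _ (p / w * expR (- (4 / V)) * expR (- theta * z) *
    (w * expR (- ((z - 1) ^+ 2 / V))))).
  by apply: ler_wpM2l => //; nneg.
have -> : p / w * expR (- (4 / V)) * expR (- theta * z) *
    (w * expR (- ((z - 1) ^+ 2 / V))) =
  p * expR (- (4 / V) + - theta * z - (z - 1) ^+ 2 / V).
  by rewrite !expRD; field; rewrite gt_eqF.
rewrite normal_pdfE ?gt_eqF//; apply: ler_wpM2l; first exact: ltW.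
rewrite /normal_fun ler_expR subr0.
have -> : - (z + 1) ^+ 2 / (V *+ 2) = - ((z + 1) ^+ 2 / 2 / V).
  by rewrite -mulr_natr; field; rewrite gt_eqF.
have -> : - (4 / V) + - theta * z - (z - 1) ^+ 2 / V =
  - (theta * z) - (4 + (z - 1) ^+ 2) / V by field; rewrite gt_eqF.
have h1 : 0 <= theta * z by rewrite mulr_ge0// ltW.
suff : (z + 1) ^+ 2 / 2 / V <= (4 + (z - 1) ^+ 2) / V by lra.
apply: ler_wpM2r; first by rewrite invr_ge0 ltW.
have := sqr_ge0 (z - 3); lra.
Qed.

(** A quantitative form of the concavity of 1 - exp (- w). *)
Lemma onem_expRN_ratio (w S : R) : 0 <= w -> 1 <= S ->
  (1 - expR (- w)) / (3 * S) <= 1 - expR (- (w / 2 / S)).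
Proof.
move=> w0 S1; have S0 : 0 < S by rewrite (lt_le_trans ltr01).
have v0 : 0 <= w / 2 / S by rewrite !divr_ge0// ltW.
set v := w / 2 / S in v0 *.
have vE : w = 2 * (S * v) by rewrite /v; field; rewrite gt_eqF.
have Sv0 : 0 <= S * v by rewrite mulr_ge0// ltW.
have H : v / (1 + v) <= 1 - expR (- v).
  rewrite lerBrDr -lerBrDl.
  have -> : 1 - v / (1 + v) = (1 + v)^-1 by field; rewrite gt_eqF// ltr_pwDl.
  by rewrite expRN lef_pV2 ?posrE ?expR_gt0 ?expR_ge1Dx// ltr_pwDl.
apply: le_trans H.
rewrite ler_pdivrMr ?mulr_gt0// mulrAC ler_pdivlMr ?ltr_pwDl//.
have ew : 1 - expR (- w) <= w by have := expR_ge1Dx (- w); lra.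
have e1 : 1 - expR (- w) <= 1 by have := expR_ge0 (- w); lra.
set e := 1 - expR (- w) in ew e1 *.
have [w1|w1] := leP w 1.
  have : v <= 1 / 2 by nra.
  nra.
nra.
Qed.

(** A narrow kernel with a weaker tilt lies below a wide kernel with the critical
    tilt, up to a factor S^(-3/2): the Gaussian decay of the narrow kernel
    absorbs the difference between the tilts. *)
Lemma dheat_tilt (t S z : R) : 0 <= t <= theta -> 1 <= S -> 0 <= z ->
  2^-1 * expR (- theta) / (3 * Num.sqrt 2) / (S * Num.sqrt S) *
    (expR (- t * z) * dheat 1 2^-1 z) <= expR (- theta * z) * dheat 1 S z.
Proof.
move=> /andP[t0 tt] S1 z0; have S0 : 0 < S by rewrite (lt_le_trans ltr01).
have sS0 : 0 < Num.sqrt S by rewrite sqrtr_gt0.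
have s20 : 0 < Num.sqrt 2 :> R by rewrite sqrtr_gt0.
rewrite !dheatE// /heat.
have -> : 2 * 1 * z / (V * 2^-1) = 4 * z / V by field; rewrite gt_eqF.
have -> : 2 * 1 * z / (V * S) = (4 * z / V) / 2 / S by field; rewrite !gt_eqF.
have -> : (Num.sqrt (2^-1 : R))^-1 = Num.sqrt 2 by rewrite sqrtrV ?invrK.
have -> : 2 * V * 2^-1 = V by field.
have w0 : 0 <= 4 * z / V by nneg.
have H := onem_expRN_ratio w0 S1.
set e := 1 - _ in H *; set e' := 1 - _ in H *.
have e0 : 0 <= e.
  by rewrite subr_ge0 -[leRHS]expR0 ler_expR oppr_le0.
have -> : 2^-1 * expR (- theta) / (3 * Num.sqrt 2) / (S * Num.sqrt S) *
  (expR (- t * z) * (Num.sqrt 2 * expR (- (z - 1) ^+ 2 / V) * e)) =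
  (Num.sqrt S)^-1 * (2^-1 * expR (- theta) * expR (- t * z) *
     expR (- (z - 1) ^+ 2 / V)) * (e / (3 * S)).
  by field; rewrite !gt_eqF.
have -> : expR (- theta * z) * ((Num.sqrt S)^-1 * expR (- (z - 1) ^+ 2 / (2 * V * S)) * e') =
   (Num.sqrt S)^-1 * (expR (- theta * z) * expR (- (z - 1) ^+ 2 / (2 * V * S))) * e'.
  by ring.
apply: ler_pM => //.
- by nneg.
apply: ler_wpM2l; first by nneg.
have -> : 2^-1 = expR (- (theta ^+ 2 * V / 2)) by rewrite expRN theta_crit.
rewrite -!expRD ler_expR.
have h1 : - (z - 1) ^+ 2 / (2 * V) <= - (z - 1) ^+ 2 / (2 * V * S).
  rewrite !mulNr lerN2; apply: ler_wpM2l; first exact: sqr_ge0.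
  rewrite lef_pV2 ?posrE ?mulr_gt0//.
  by rewrite -[leLHS]mulr1; apply: ler_wpM2l => //; rewrite mulr_ge0// ltW.
apply: (@le_trans _ _ (- theta * z + - (z - 1) ^+ 2 / (2 * V))); last by rewrite lerD2l.
have h2 : - t * z <= 0 by rewrite mulNr oppr_le0 mulr_ge0.
have -> : - (z - 1) ^+ 2 / V = - (z - 1) ^+ 2 / (2 * V) + - (z - 1) ^+ 2 / (2 * V).
  by field; rewrite gt_eqF.
(* the minimum over z of (z - 1)^2 / 2V - theta z, attained at z = 1 + theta V *)
have h3 : 0 <= (z - 1 - theta * V) ^+ 2 / (2 * V).
  by rewrite divr_ge0 ?sqr_ge0// mulr_ge0// ltW.
have h4 : (z - 1 - theta * V) ^+ 2 / (2 * V) =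
   (z - 1) ^+ 2 / (2 * V) - theta * (z - 1) + theta ^+ 2 * V / 2.
  by field; rewrite gt_eqF.
rewrite h4 in h3; rewrite mulNr; lra.
Qed.

End lower_bound_start.

Section two_speeds.
Context {R : realType} (sigma theta : R).
Hypothesis sigma_gt0 : 0 < sigma.
Local Notation V := (sigma ^+ 2).
Hypothesis theta_gt0 : 0 < theta.
Hypothesis theta_crit : expR (theta ^+ 2 * V / 2) = 2.
Local Notation max_tail := (max_tail sigma).
Local Notation gconv := (gconv sigma).
Local Notation dheat := (dheat sigma).

Let V_gt0 : 0 < V. Proof. exact: exprn_gt0. Qed.

Lemma dheat_at1 s : 2^-1 <= s -> ((V + 4) * s ^+ 2)^-1 <= dheat 1 s 1.
Proof.
move=> s2; have s0 : 0 < s by rewrite (lt_le_trans _ s2).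
have V40 : 0 < V + 4 by rewrite addr_gt0.
rewrite dheatE// /heat subrr expr0n oppr0 mul0r expR0 !mulr1.
have w0 : 0 < 2 / (V * s) by rewrite divr_gt0// mulr_gt0.
have h1 : (2 * s)^-1 <= (Num.sqrt s)^-1.
  rewrite lef_pV2 ?posrE ?sqrtr_gt0 ?mulr_gt0//.
  rewrite -[leRHS]gtr0_norm ?mulr_gt0// -sqrtr_sqr ler_sqrt ?sqr_ge0//.
  have : 0 <= s * (s - 2^-1) by rewrite mulr_ge0 ?subr_ge0// ltW.
  lra.
have h2 : 2 / ((V + 4) * s) <= 1 - expR (- (2 / (V * s))).
  have e1 : expR (- (2 / (V * s))) <= (1 + 2 / (V * s))^-1.
    by rewrite expRN lef_pV2 ?posrE ?expR_gt0 ?expR_ge1Dx// ltr_pwDl// ltW.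
  have Vs2 : 0 < V * s + 2 by rewrite addr_gt0// mulr_gt0.
  apply: (@le_trans _ _ (1 - (1 + 2 / (V * s))^-1)); last by lra.
  have -> : 1 - (1 + 2 / (V * s))^-1 = 2 / (V * s + 2).
    by field; rewrite ?gt_eqF.
  apply: ler_wpM2l => //; rewrite lef_pV2 ?posrE ?mulr_gt0//; lra.
have -> : ((V + 4) * s ^+ 2)^-1 = (2 * s)^-1 * (2 / ((V + 4) * s)).
  by field; rewrite ?gt_eqF.
apply: ler_pM => //; first by rewrite invr_ge0 mulr_ge0// ltW.
by rewrite divr_ge0// mulr_ge0// ltW.
Qed.

(** Critical speed for n generations, then the slower speed t V for m generations.
    The bound on r ^+ m says that the exponential growth of the second phase does
    not exceed the factor n^(3/2) lost in the first, which is exactly what keeps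
    the amplitude small enough for the subsolution. *)
Lemma max_tail_ge_two_speeds (t : R) : 0 < t <= theta ->
  exists2 k : R, 0 < k & forall n m : nat, let S := 2^-1 + n%:R in
    let r := 2 * expR (- (t ^+ 2 * V / 2)) in
    (0 < n)%N -> r ^+ m <= 3 * (S * Num.sqrt S) ->
    k * r ^+ m / (S * Num.sqrt S) / m.+1%:R ^+ 2 <=
      max_tail (1 + n + m) (theta * V * n%:R + t * V * m%:R + 1).
Proof.
move=> /andP[t0 tt].
have [q0 q00 Hq0] := max_tail1_ge sigma_gt0 theta_gt0.
pose w : R := Num.sqrt 2^-1.
have w0 : 0 < w by rewrite sqrtr_gt0.
(* q is so small that the smallness condition of [max_tail_ge_iter] holds in
   both phases *)
pose q := Num.min q0 (V * t * w / 3).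
have q_gt0 : 0 < q by rewrite lt_min q00 divr_gt0// !mulr_gt0.
have qw : 3 * q <= V * t * w.
  have : q <= V * t * w / 3 by rewrite ge_min lexx orbT.
  lra.
(* the constant of [dheat_tilt] *)
pose k0 := 2^-1 * expR (- theta) / (3 * Num.sqrt 2).
have s2 : 0 < Num.sqrt 2 :> R by rewrite sqrtr_gt0.
have k00 : 0 < k0 by rewrite divr_gt0// mulr_gt0// expR_gt0.
have k01 : k0 <= 1.
  rewrite ler_pdivrMr ?mulr_gt0//.
  have : expR (- theta) <= 1 by rewrite -[leRHS]expR0 ler_expR oppr_le0 ltW.
  have : 1 <= Num.sqrt 2 :> R by rewrite -[leLHS]sqrtr1 ler_sqrt ?ler1n.
  lra.
pose c := 2^-1 * (2^-1 * q * k0) * expR (- t) / (V + 4).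
exists c.
  rewrite /c divr_gt0 ?addr_gt0// !mulr_gt0 ?expR_gt0//.
move=> n m S r n0 rm.
have S1 : 1 <= S.
  have : 1 <= n%:R :> R by rewrite ler1n.
  rewrite /S; lra.
have S0 : 0 < S by rewrite (lt_le_trans ltr01).
have sS0 : 0 < Num.sqrt S by rewrite sqrtr_gt0.
have r1 : 1 <= r.
  have <- : 2 * expR (- (theta ^+ 2 * V / 2)) = 1.
    by rewrite expRN theta_crit divff.
  rewrite ler_pM2l// ler_expR lerN2.
  rewrite ler_pM2r ?invr_gt0// ler_pM2r//.
  by apply: lerXn2r => //; rewrite nnegrE ltW.
have r0 : 0 < r by rewrite (lt_le_trans ltr01).
have base1 z : q * expR (- theta * z) * dheat 1 2^-1 z <= max_tail 1 (0 + z).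
  rewrite add0r; have [z0|/ltW z0] := leP 0 z; last first.
    apply: (@le_trans _ _ 0); last exact: max_tail_ge0.
    by rewrite mulr_ge0_le0 ?dheat_le0//; nneg.
  apply: le_trans (Hq0 z); apply: ler_wpM2r; first exact: dheat_ge0.
  by apply: ler_wpM2r => //; rewrite ge_min lexx.
have rcrit : 2 * expR (- (theta ^+ 2 * V / 2)) = 1.
  by rewrite expRN theta_crit divff.
have half0 : 0 < 2^-1 :> R by rewrite invr_gt0.
have st2 z : 2^-1 * q * expR (- theta * z) * dheat 1 S z <=
    max_tail (1 + n) (theta * V * n%:R + z).
  have := @max_tail_ge_iter _ _ sigma_gt0 theta q 2^-1 0 1 n theta_gt0 (ltW q_gt0) half0.
  cbv zeta; rewrite rcrit expr1n mulr1 add0r; apply => //.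
  have : V * t * w <= V * theta * w.
    by rewrite ler_pM2r// ler_pM2l.
  rewrite -/w; lra.
pose q' := 2^-1 * q * k0 / (S * Num.sqrt S).
have q'0 : 0 < q'.
  by apply: divr_gt0; [apply: mulr_gt0; [apply: mulr_gt0|]|apply: mulr_gt0].
have base3 z : q' * expR (- t * z) * dheat 1 2^-1 z <=
    max_tail (1 + n) (theta * V * n%:R + z).
  have [z0|/ltW z0] := leP 0 z; last first.
    apply: (@le_trans _ _ 0); last exact: max_tail_ge0.
    by rewrite mulr_ge0_le0 ?dheat_le0//; nneg.
  apply: le_trans (st2 z).
  have tt' : 0 <= t <= theta by rewrite tt ltW.
  have := dheat_tilt sigma_gt0 theta_crit tt' S1 z0; rewrite -/k0 => h.
  have := ler_wpM2l (ltW (mulr_gt0 half0 q_gt0)) h.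
  by rewrite /q' !mulrA.
have small : 2 * (q' * r ^+ m) <= V * t * Num.sqrt 2^-1.
  apply: le_trans qw.
  have -> : 2 * (q' * r ^+ m) = q * (k0 * (r ^+ m / (S * Num.sqrt S))).
    by rewrite /q'; field; rewrite ?gt_eqF.
  rewrite [leRHS]mulrC; apply: ler_wpM2l; first exact: ltW.
  rewrite -[leRHS]mul1r; apply: ler_pM => //; [exact: ltW| |].
    by nneg; exact: ltW.
  by rewrite ler_pdivrMr ?mulr_gt0.
have := max_tail_ge_iter sigma_gt0 t0 (ltW q'0) half0 r1 small base3 1.
apply: le_trans.
have sm : 2^-1 <= 2^-1 + m%:R :> R by rewrite lerDl.
have m0 : 0 < 2^-1 + m%:R :> R by rewrite (lt_le_trans half0).
have V40 : 0 < V + 4 by rewrite addr_gt0.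
have -> : c * r ^+ m / (S * Num.sqrt S) / m.+1%:R ^+ 2 =
   2^-1 * (q' * r ^+ m) * expR (- t * 1) * ((V + 4) * m.+1%:R ^+ 2)^-1.
  rewrite mulr1 /c /q'; field.
  by rewrite ?gt_eqF// -(natr1 m) ltr_wpDl.
apply: ler_wpM2l; first by nneg; exact: ltW.
apply: le_trans (dheat_at1 sm).
rewrite lef_pV2 ?posrE ?mulr_gt0 ?exprn_gt0//.
rewrite ler_pM2l//; apply: lerXn2r; rewrite ?nnegrE ?(ltW m0)//.
rewrite -(natr1 m); lra.
Qed.

End two_speeds.

Section boosting.
Context {R : realType} (sigma : R).
Hypothesis sigma_gt0 : 0 < sigma.
Local Notation V := (sigma ^+ 2).
Local Notation max_tail := (max_tail sigma).
Local Notation gconv := (gconv sigma).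

Let V_gt0 : 0 < V. Proof. exact: exprn_gt0. Qed.

(** Lowering the level by a large B makes one increment harmless with probability
    close to 1, and the map p |-> 2 q p - (q p)^2 with q close to 1 expands away
    from 0 until p is close to 1. *)
Lemma max_tail_boost (del : R) : 0 < del < 1 -> exists2 B : R, 0 <= B &
  forall n x p, 0 <= p -> p <= max_tail n x ->
    Num.min (1 - del) ((1 + del / 2) * p) <= max_tail n.+1 (x - B).
Proof.
move=> /andP[d0 d1].
(* by Markov's inequality an increment is below - B with probability at most
   expR (V / 2 - B) <= del / 4 *)
pose B := V / 2 + 4 / del.
have B0 : 0 <= B by rewrite addr_ge0// divr_ge0// ltW.
exists B => // n x p p0 px.
have qB : expR (V / 2 - B) <= del / 4.
  rewrite /B opprD addrA subrr add0r; apply: (le_trans (expRN_le_inv _)).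
    by rewrite divr_gt0.
  by rewrite invf_div.
have [ei eE] := gconv_exp sigma_gt0 (- 1).
have K : (1 - del / 4) * p <= gconv (max_tail n) (x - B).
  (* g is at most p for z <= x and negative for z > x *)
  pose g z := p - p * expR (- x) * expR (- -1 * z).
  have ci : gconv_integrable sigma (cst p).
    by apply: (@gconv_integrable_bounded _ _ `|p|).
  have gi := gconv_integrableZ (p * expR (- x)) ei.
  apply: (@le_trans _ _ (gconv g (x - B))).
    rewrite /g gconvB// gconvZ// eE [gconv _ _]gconv_cst -(mulrA p) -expRD.
    have -> : - x + ((-1) ^+ 2 * V / 2 - -1 * (x - B)) = V / 2 - B by field.
    have := ler_wpM2l p0 qB; lra.
  apply: le_gconv; [exact: gconv_integrableB|exact: max_tail_integrable|] => z.
  rewrite /g -mulrA -expRD opprK mul1r.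
  have [zx|/ltW xz] := leP z x.
    apply: (@le_trans _ _ p); first by rewrite gerBl mulr_ge0.
    by apply: (le_trans px); exact: max_tail_nonincreasing.
  apply: (@le_trans _ _ 0); last exact: max_tail_ge0.
  rewrite subr_le0 -[leLHS]mulr1; apply: ler_wpM2l => //.
  by rewrite -[leLHS]expR0 ler_expR addrC subr_ge0.
have K1 := gconv_max_tail_le1 sigma n (x - B).
rewrite max_tailS; set k := gconv _ _ in K K1 *.
have [kd|kd] := leP (1 - del) k.
  rewrite ge_min; apply/orP; left.
  have : 0 <= k * (1 - k) by rewrite mulr_ge0; lra.
  lra.
rewrite ge_min; apply/orP; right.
have k0 : 0 <= (1 - del / 4) * p by rewrite mulr_ge0//; lra.
have h1 : 0 <= k * (1 - del - k) by rewrite mulr_ge0; lra.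
have h2 : 0 <= (k - (1 - del / 4) * p) * (1 + del) by rewrite mulr_ge0; lra.
have h3 : 0 <= del * (1 - del) * p by rewrite !mulr_ge0//; lra.
lra.
Qed.

Lemma max_tail_boost_iter (del : R) : 0 < del < 1 -> exists2 B : R, 0 <= B &
  forall (j n : nat) x p, 0 <= p -> p <= max_tail n x ->
    Num.min (1 - del) ((1 + del / 2) ^+ j * p) <= max_tail (n + j) (x - B * j%:R).
Proof.
move=> del01; have [B B0 H] := max_tail_boost del01.
exists B => // j n x p p0 px; case/andP: del01 => d0 d1.
have lam1 : 1 <= 1 + del / 2 by rewrite lerDl divr_ge0// ltW.
elim: j => [|j IH].
  by rewrite mulr0 subr0 addn0 expr0 mul1r ge_min px orbT.
set P := Num.min _ _ in IH.
have lam0 : 0 <= 1 + del / 2 by rewrite (le_trans ler01).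
have P0 : 0 <= P by rewrite le_min subr_ge0 (ltW d1) /=; nneg.
have -> : x - B * j.+1%:R = x - B * j%:R - B by rewrite -(natr1 j); ring.
rewrite addnS; apply: le_trans (H _ _ _ P0 IH).
rewrite !le_min ge_min lexx /=.
rewrite /P; have [h|h] := leP (1 - del) ((1 + del / 2) ^+ j * p).
  rewrite ge_min; apply/orP; left; rewrite -[leLHS]mul1r.
  by apply: ler_wpM2r => //; lra.
by rewrite exprS mulrA ge_min lexx orbT.
Qed.

End boosting.

Section lower_bound.
Context {R : realType} (sigma theta : R).
Hypothesis sigma_gt0 : 0 < sigma.
Local Notation V := (sigma ^+ 2).
Hypothesis theta_gt0 : 0 < theta.
Hypothesis theta_crit : expR (theta ^+ 2 * V / 2) = 2.
Local Notation max_tail := (max_tail sigma).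

Let V_gt0 : 0 < V. Proof. exact: exprn_gt0. Qed.

(** At t = theta the left side is 3 / (2 theta), so by continuity there is room
    for some t < theta, which does not depend on n. *)
Lemma slower_speed (eps : R) : 0 < eps -> exists2 t : R, 0 < t < theta &
  3 / (theta + t) <= 3 / (2 * theta) + eps / 4.
Proof.
move=> eps0; pose u := Num.min (theta / 2) (eps * theta ^+ 2 / 6).
have u0 : 0 < u by rewrite lt_min !divr_gt0// mulr_gt0// exprn_gt0.
have u1 : u <= theta / 2 by rewrite ge_min lexx.
have u2 : u <= eps * theta ^+ 2 / 6 by rewrite ge_min lexx orbT.
exists (theta - u); first by apply/andP; split; lra.
have tu : 0 < theta + (theta - u) by lra.
rewrite ler_pdivrMr//.
have -> : (3 / (2 * theta) + eps / 4) * (theta + (theta - u)) =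
  3 + (eps * theta ^+ 2 / 6 * 3 - u * 3) / (2 * theta) + eps / 4 * (theta - u).
  by field; rewrite gt_eqF.
have h1 : 0 <= (eps * theta ^+ 2 / 6 * 3 - u * 3) / (2 * theta).
  by apply: divr_ge0; [lra|rewrite mulr_ge0// ltW].
have h2 : 0 <= eps / 4 * (theta - u) by apply: mulr_ge0; [rewrite divr_ge0// ltW|lra].
lra.
Qed.

Lemma max_tail_lower (eps del : R) : 0 < eps -> 0 < del < 1 ->
  exists K : R, forall N : nat, K <= ln N%:R ->
  1 - del <= max_tail N (theta * V * N%:R - (3 / (2 * theta) + eps) * ln N%:R).
Proof.
move=> eps0 del01.
have s2 : Num.sqrt 2 <= 3 / 2 :> R.
  rewrite -[leRHS]gtr0_norm// -sqrtr_sqr ler_sqrt ?sqr_ge0//; lra.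
have [t /andP[t0 tt] teps] := slower_speed eps0.
have t_range : 0 < t <= theta by rewrite t0 ltW.
have [k k0 Hk] := max_tail_ge_two_speeds sigma_gt0 theta_gt0 theta_crit t_range.
have [B B0 HB] := max_tail_boost_iter sigma_gt0 del01.
case/andP: (del01) => d0 d1.
pose r := 2 * expR (- (t ^+ 2 * V / 2)).
pose lr := (theta ^+ 2 - t ^+ 2) * V / 2.
have rE : r = expR lr.
  by rewrite /r -[X in X * expR _]theta_crit -expRD /lr; congr expR; field.
have t2 : t ^+ 2 < theta ^+ 2 by rewrite ltr_pXn2r// nnegrE ltW.
have lr0 : 0 < lr.
  rewrite /lr divr_gt0// mulr_gt0// subr_gt0.
  exact: t2.
pose lam := 1 + del / 2.
have lam1 : 1 < lam by rewrite ltrDl divr_gt0.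
have lam0 : 0 < lam by rewrite (lt_trans ltr01).
have ll0 : 0 < ln lam by rewrite ln_gt0.
pose M := theta * V + B + 1.
have M0 : 0 < M by rewrite ltr_wpDl//; nneg.
(* each generation of the third phase costs at most M in level, so that this
   phase costs at most (eps / 4) T *)
pose kap := eps / (4 * M).
have kap0 : 0 < kap by rewrite divr_gt0// mulr_gt0.
pose D := 3 / 2 / lr + kap.
have D0 : 0 < D by rewrite addr_gt0// divr_gt0.
have D10 : 0 < D + 1 by rewrite addr_gt0.
have r0 : 0 < r by rewrite rE expR_gt0.
pose c := k / r / (D + 1) ^+ 2.
have c0 : 0 < c by rewrite !divr_gt0// exprn_gt0.
pose a := kap * ln lam.
have a0 : 0 < a by rewrite mulr_gt0.
pose K1 := (3 / a) ^+ 3 * lam / c.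
have K10 : 0 <= K1 by rewrite /K1; nneg; exact: ltW.
pose K2 := 4 * (theta * V) / eps.
have K20 : 0 <= K2 by rewrite /K2; nneg; exact: ltW.
exists (K1 + K2 + 8 * D + 8) => N.
set T := ln N%:R => TK.
have T8 : 8 * D + 8 <= T by move: TK K10 K20; clear; lra.
have T1 : 1 <= T by move: T8 D0; clear; lra.
have T0 : 0 < T by rewrite (lt_le_trans ltr01).
have N0 : 0 < N%:R :> R.
  by rewrite ltNge; apply/negP => n0; move: T0; rewrite /T ln0// ltxx.
have NE : N%:R = expR T by rewrite lnK.
pose m := Num.truncn (3 / 2 * T / lr); pose j := Num.truncn (kap * T).
have /truncn_itv/andP[m_le m_gt] : 0 <= 3 / 2 * T / lr.
  by apply: divr_ge0 (ltW lr0); rewrite mulr_ge0// ltW.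
have /truncn_itv/andP[j_le j_gt] : 0 <= kap * T by rewrite mulr_ge0// ltW.
rewrite -/m in m_le m_gt; rewrite -/j in j_le j_gt.
rewrite -(natr1 m) in m_gt; rewrite -(natr1 j) in j_gt.
have mj : m%:R + j%:R <= D * T.
  have -> : D * T = 3 / 2 * T / lr + kap * T by rewrite /D; ring.
  exact: lerD.
(* the last two phases take a logarithmic number of generations *)
have bigN : 2 * (1 + m%:R + j%:R) <= N%:R :> R.
  have : (1 + T / 2) ^+ 2 <= N%:R.
    have -> : N%:R = expR (T / 2) ^+ 2 by rewrite expr2 -expRD -splitr.
    by apply: lerXn2r; rewrite ?nnegrE ?expR_ge0 ?expR_ge1Dx//;
      rewrite addr_ge0// divr_ge0// ltW.
  have : 0 <= (T - (8 * D + 8)) * T by rewrite mulr_ge0 ?subr_ge0// ltW.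
  have : 0 <= D * T by rewrite mulr_ge0// ltW.
  move: mj T1; clear; lra.
pose n := (N - (1 + m + j))%N.
have lN : (1 + m + j < N)%N.
  rewrite -(ltr_nat R) !natrD; have := ler0n R m; have := ler0n R j.
  by move: bigN; clear; lra.
have NnE : N = (1 + n + m + j)%N.
  by rewrite -[LHS](subnK (ltnW lN)) -/n !addnA (addnC n).
have nR : N%:R = 1 + n%:R + m%:R + j%:R :> R by rewrite {1}NnE !natrD.
have n_gt0 : (0 < n)%N by rewrite subn_gt0.
pose S : R := 2^-1 + n%:R.
have S_ge : N%:R <= 2 * S by rewrite /S; move: bigN nR; clear; lra.
have S_le : S <= N%:R.
  have := ler0n R m; have := ler0n R j; rewrite /S.
  by move: nR; clear; lra.
have S0 : 0 < S by move: S_ge N0; clear; lra.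
have sS0 : 0 < Num.sqrt S by rewrite sqrtr_gt0.
have N32 : N%:R * Num.sqrt N%:R = expR (3 / 2 * T).
  have -> : Num.sqrt N%:R = expR (T / 2).
    by rewrite NE [in LHS](splitr T) expRD -expr2 sqrtr_sqr gtr0_norm ?expR_gt0.
  by rewrite NE -expRD; congr expR; field.
have rm_le : r ^+ m <= expR (3 / 2 * T).
  rewrite rE -expRM_natl ler_expR.
  by rewrite -ler_pdivlMr.
have rm_ge : expR (3 / 2 * T) / r <= r ^+ m.
  rewrite {1}rE -expRN -expRD rE -expRM_natl ler_expR.
  have := m_gt; rewrite ltr_pdivrMr// => /ltW; clear; lra.
have S32 : S * Num.sqrt S <= expR (3 / 2 * T).
  by rewrite -N32; apply: ler_pM => //; rewrite ?ler_sqrt// ltW.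
have rmS : r ^+ m <= 3 * (S * Num.sqrt S).
  apply: (le_trans rm_le); rewrite -N32.
  apply: (@le_trans _ _ (2 * S * (Num.sqrt 2 * Num.sqrt S))).
    by apply: ler_pM => //; rewrite -?sqrtrM// ler_sqrt// mulr_ge0// ltW.
  have -> : 2 * S * (Num.sqrt 2 * Num.sqrt S) = 2 * (S * Num.sqrt S) * Num.sqrt 2 by ring.
  have -> : 3 * (S * Num.sqrt S) = 2 * (S * Num.sqrt S) * (3 / 2) by field.
  by apply: ler_wpM2l => //; nneg; exact: ltW.
have := Hk n m n_gt0 rmS.
rewrite -/r -/S; set p := k * _ / _ / _; set x := _ + 1 => px.
have m1 : m.+1%:R <= (D + 1) * T.
  by rewrite -(natr1 m); have := ler0n R j; move: mj T1; clear; lra.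
have p_ge : c / T ^+ 2 <= p.
  have -> : c / T ^+ 2 = k * r^-1 / ((D + 1) * T) ^+ 2.
    by rewrite /c; field; rewrite ?gt_eqF.
  rewrite /p; apply: ler_pM.
  - by nneg; exact: ltW.
  - by nneg; exact: ltW.
  - rewrite -mulrA; apply: ler_wpM2l; first exact: ltW.
    rewrite ler_pdivlMr ?mulr_gt0//; apply: le_trans rm_ge.
    by rewrite mulrC; apply: ler_wpM2r => //; rewrite invr_ge0 ltW.
  - rewrite lef_pV2 ?posrE ?exprn_gt0 ?mulr_gt0//.
    by apply: lerXn2r => //; rewrite nnegrE ?ler0n//; nneg.
have p0 : 0 <= p by apply: le_trans p_ge; nneg; exact: ltW.
have lamj : expR (a * T) / lam <= lam ^+ j.
  have lamE : lam = expR (ln lam) by rewrite lnK.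
  rewrite [X in _ / X]lamE -expRN -expRD [X in X ^+ _]lamE -expRM_natl ler_expR.
  rewrite /a; have := ler_wpM2r (ltW ll0) (ltW j_gt); clear; lra.
have big : 1 <= lam ^+ j * p.
  have H := exprX_expRN_le 2 a0 T0.
  apply: (@le_trans _ _ (expR (a * T) / lam * (c / T ^+ 2))); last first.
    by apply: ler_pM => //; nneg; exact: ltW.
  rewrite -(expRxMexpNx_1 (a * T)).
  have -> : expR (a * T) / lam * (c / T ^+ 2) = expR (a * T) * (c / lam / T ^+ 2) by ring.
  apply: ler_wpM2l; first exact: expR_ge0.
  rewrite ler_pdivlMr ?exprn_gt0// mulrC; apply: (le_trans H).
  have K1T : K1 <= T by move: TK K20 D0; clear; lra.
  rewrite /K1 ler_pdivrMr// in K1T.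
  by rewrite ler_pdivrMr// mulrAC ler_pdivlMr// [leRHS]mulrC.
have := HB j (1 + n + m)%N x p p0 px.
rewrite -NnE => HH.
have minE : Num.min (1 - del) ((1 + del / 2) ^+ j * p) = 1 - del.
  by apply/min_idPl; rewrite (le_trans _ big)// lerBlDr lerDl ltW.
rewrite minE in HH; apply: (le_trans HH); apply: max_tail_nonincreasing.
rewrite /x nR.
have e1 : (theta - t) * V * m%:R <= (3 / (2 * theta) + eps / 4) * T.
  apply: (@le_trans _ _ (3 / (theta + t) * T)); last by apply: ler_wpM2r => //; exact: ltW.
  have -> : 3 / (theta + t) * T = (theta - t) * V * (3 / 2 * T / lr).
    rewrite /lr; field; rewrite ?gt_eqF//; first by rewrite addr_gt0.
    by rewrite subr_gt0.
  by apply: ler_wpM2l => //; rewrite mulr_ge0 ?subr_ge0// ltW.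
have e2 : (theta * V + B) * j%:R <= eps / 4 * T.
  apply: (@le_trans _ _ (M * (kap * T))).
    apply: ler_pM => //; last by rewrite /M lerDl.
    by rewrite addr_ge0// mulr_ge0// ltW.
  by rewrite le_eqVlt; apply/orP; left; apply/eqP; rewrite /kap; field; rewrite gt_eqF.
have e3 : theta * V <= eps / 4 * T.
  have : K2 <= T by move: TK K10 D0; clear; lra.
  rewrite /K2 ler_pdivrMr//; clear; lra.
have e4 : 0 <= eps * T by rewrite mulr_ge0// ltW.
rewrite -/T; move: e1 e2 e3 e4; clear; lra.
Qed.
End lower_bound.

(** * Events generated by subfamilies of an independent family *)

Section independent_subfamilies.
Context d (T : measurableType d) (R : realType) (P : probability T R).
Variables (I : finType) (X : I -> {RV P >-> R}).
Hypothesis indepX : mutually_independent X.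
Implicit Types (A : {set I}) (E F : set T).

(** The subfamily is indexed by all of A, some of the sets B i being possibly the
    whole line: this makes the class stable under intersection. *)
Definition cylinders A : set (set T) :=
  [set E | exists2 B : I -> set R, (forall i, measurable (B i)) &
    E = \bigcap_(i in [set` A]) (X i @^-1` B i)].

Definition events A : set (set T) := <<s cylinders A >>.

(** Measurability with respect to the subfamily indexed by A. *)
Definition adapted A (f : T -> R) :=
  measurable_fun [set: g_sigma_algebraType (cylinders A)] f.

Lemma cylinders_setI A : setI_closed (cylinders A).
Proof.
move=> _ _ [B mB ->] [C mC ->]; exists (fun i => B i `&` C i).
  by move=> i; exact: measurableI.
by rewrite -bigcapI; apply: eq_bigcapr.
Qed.

Lemma measurable_cylinders A E : cylinders A E -> measurable E.
Proof.
move=> [B mB ->]; apply: fin_bigcap_measurable; first exact: finite_finpred.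
by move=> i _; apply: measurable_funPTI.
Qed.

Lemma measurable_events A E : events A E -> measurable E.
Proof.
move=> AE; apply: AE; split; first exact: sigma_algebra_measurable.
exact: measurable_cylinders.
Qed.

Definition independent_of F : set (set T) :=
  [set E | measurable E /\ P (@setI T E F) = (P E * P F)%E].

Lemma independent_of_dynkin F : measurable F -> dynkin (independent_of F).
Proof.
move=> mF; split.
- by split => //; rewrite setTI probability_setT mul1e.
- move=> E [mE EF]; split; first exact: measurableC.
  have -> : ~` E `&` F = F `\` E by rewrite setDE setIC.
  rewrite measureD//; last by rewrite (le_lt_trans (probability_le1 _ _))// ltry.
  rewrite (setIC F) [X in (_ - X)%E]EF probability_setC// muleBl// ?mul1e//.
  by rewrite fin_num_measure.
- move=> E tE iE; split; first by apply: bigcup_measurable => k _; have [] := iE k.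
  rewrite setI_bigcupl !measure_bigcup//; last 3 first.
  + by move=> k _; have [] := iE k.
  + by move=> k _; apply: measurableI => //; have [] := iE k.
  + exact: trivIset_setIr.
  have PF : P F = (fine (P F))%:E by rewrite fineK// fin_num_measure.
  rewrite muleC [X in (X * _)%E]PF -nneseriesZl//.
  by apply: eq_eseriesr => k _; rewrite -PF muleC; have [] := iE k.
Qed.

Lemma cylinders_independent A1 A2 E F : (forall i, i \in A1 -> i \notin A2) ->
  cylinders A1 E -> cylinders A2 F -> P (@setI T E F) = (P E * P F)%E.
Proof.
move=> dA [B mB ->] [C mC ->].
pose D i := if i \in A1 then B i else C i.
have mD i : measurable (D i) by rewrite /D; case: ifP.
have -> : \bigcap_(i in [set` A1]) (X i @^-1` B i) `&`
    \bigcap_(i in [set` A2]) (X i @^-1` C i) =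
    \bigcap_(i in [set` A1 :|: A2]) (X i @^-1` D i).
  apply/seteqP; split => t /=.
    move=> [t1 t2] i; rewrite /= inE /D; case: ifPn => [iA1 _|_ /= iA2].
      exact: t1.
    exact: t2.
  move=> tt; split => i /= iA.
    by have := tt i; rewrite /= inE iA /D iA; exact.
  have := tt i; rewrite /= inE iA orbT /D ifN; first by exact.
  by apply/negP => /dA; rewrite iA.
rewrite !indepX// (bigID (mem A1))/=; congr (_ * _)%E; apply: eq_big => i.
- by rewrite inE andb_orl andbb; case: (i \in A1); rewrite ?andbT ?andbF.
- by case/andP=> _ iA; rewrite /D iA.
- by rewrite inE; case: (boolP (i \in A1)) => [/dA/negPf ->|_] /=; rewrite ?andbT.
- by case/andP=> _ iA; rewrite /D ifN.
Qed.

(** The pi-lambda theorem, applied to one family and then to the other. *)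
Lemma events_independent A1 A2 E F : (forall i, i \in A1 -> i \notin A2) ->
  events A1 E -> events A2 F -> P (@setI T E F) = (P E * P F)%E.
Proof.
move=> dA E1 F2.
have sub G A : measurable G -> cylinders A `<=` independent_of G ->
    events A `<=` independent_of G.
  move=> mG AG; apply: lambda_system_subset => //.
  - exact: cylinders_setI.
  - exact/dynkin_lambda_system/independent_of_dynkin.
have cF F' : cylinders A2 F' -> events A1 `<=` independent_of F'.
  move=> cF'; apply: sub; first exact: measurable_cylinders cF'.
  move=> E' cE'; split; first exact: measurable_cylinders cE'.
  exact: cylinders_independent dA cE' cF'.
have /(_ F F2)[_ ] : events A2 `<=` independent_of E.
  apply: sub; first exact: measurable_events E1.
  move=> F' cF'; split; first exact: measurable_cylinders cF'.
  by rewrite setIC muleC; have [_] := cF F' cF' E E1.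
by rewrite setIC muleC.
Qed.

Lemma adaptedX A i : i \in A -> adapted A (X i).
Proof.
move=> iA _ B mB; rewrite setTI; apply: sub_sigma_algebra.
exists (fun j => if j == i then B else setT).
  by move=> j; case: ifP.
apply/seteqP; split => t /=.
  by move=> Bt j _ /=; case: eqP => // ->.
by move=> /(_ i iA) /=; rewrite eqxx.
Qed.

Lemma adaptedS A1 A2 f : {subset A1 <= A2} -> adapted A1 f -> adapted A2 f.
Proof.
move=> sA mf _ B mB; have := mf measurableT B mB.
apply: smallest_sub; first exact: smallest_sigma_algebra.
move=> _ [C mC ->]; apply: sub_sigma_algebra; exists (fun i => if i \in A1 then C i else setT).
  by move=> i; case: ifP.
apply/seteqP; split => t /= H i /= iA.
  by case: ifPn => // iA1; exact: H.
by have := H i (sA i iA); rewrite /= iA.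
Qed.

Lemma adapted_measurable A f : adapted A f -> measurable_fun setT f.
Proof. by move=> mf _ B mB; apply: (@measurable_events A); exact: mf. Qed.

Lemma adapted_independent A1 A2 f g (B C : set R) :
  (forall i, i \in A1 -> i \notin A2) ->
  adapted A1 f -> adapted A2 g -> measurable B -> measurable C ->
  P (@setI T (f @^-1` B) (g @^-1` C)) = (P (f @^-1` B) * P (g @^-1` C))%E.
Proof.
move=> dA mf mg mB mC; apply: (events_independent dA).
  by rewrite -[_ @^-1` _]setTI; exact: mf.
by rewrite -[_ @^-1` _]setTI; exact: mg.
Qed.

End independent_subfamilies.

(** The joint law of f and g is the product of their laws, and the measure of a
    half-plane is computed by sections. *)
Lemma probability_sum_le d (T : measurableType d) (R : realType)
    (P : probability T R) (sigma : R) (f g : T -> R)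
    (x : R) :
  measurable_fun setT f -> measurable_fun setT g ->
  (forall B, measurable B -> P (f @^-1` B) = normal_prob 0 sigma B) ->
  (forall B C : set R, measurable B -> measurable C ->
    P (@setI T (f @^-1` B) (g @^-1` C)) = (P (f @^-1` B) * P (g @^-1` C))%E) ->
  (P [set t | (f t + g t <= x)%R] =
   \int[normal_prob 0 sigma]_y P [set t | (g t <= x - y)%R])%E.
Proof.
move=> mf mg fm fg.
pose U : measurableType _ := measurableTypeR R.
have mf' : measurable_fun setT (f : T -> U) by exact: mf.
have mg' : measurable_fun setT (g : T -> U) by exact: mg.
have mfg : measurable_fun setT (fun t => (f t, g t) : U * U).
  exact/measurable_fun_pair.
pose g' : {mfun T >-> U} := HB.pack (g : T -> U) (isMeasurableFun.Build _ _ _ _ _ mg').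
pose fg' : {mfun T >-> (U * U)%type} :=
  HB.pack (fun t => (f t, g t) : U * U) (isMeasurableFun.Build _ _ _ _ _ mfg).
pose E : set (U * U) := [set p | (p.1 : R) + (p.2 : R) <= x].
have mE : measurable E.
  rewrite [E](_ : _ = (fun p : U * U => (p.1 : R) + (p.2 : R)) @^-1` `]-oo, x]%classic).
    rewrite -[X in measurable X]setTI.
    have : measurable_fun setT (fun p : U * U => (p.1 : R) + (p.2 : R)).
      apply: measurable_funD; [exact: measurable_fst|exact: measurable_snd].
    by apply.
  by apply/seteqP; split => p /=; rewrite /E /= in_itv.
have := @product_measure_unique _ _ U U R (normal_prob 0 sigma)
  (distribution P g') (distribution P fg') _ E mE.
move=> H; transitivity (distribution P fg' E); first by [].
rewrite -H; last first.
  by move=> B C mB mC; apply: (etrans (fg B C mB mC)); congr (_ * _)%E; exact: fm.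
apply: eq_integral => y _ /=.
congr (P _); apply/seteqP; split => t /=; rewrite /xsection /= inE /E /=.
  by rewrite lerBrDl.
by rewrite lerBrDl.
Qed.

(** * The maximum of the branching random walk *)

Section tree_recursion.
Context d (T : measurableType d) (R : realType) (P : probability T R).
Variables (sigma : R) (n : nat) (Y : edge n -> {RV P >-> R}).

Definition edge_word (e : edge n) : seq bool := val (val e).

(** At most one edge has the word w; the sum gives the value 0 to the words that
    are not edges. *)
Definition word_step (w : seq bool) (t : T) : R :=
  \sum_(e : edge n | edge_word e == w) Y e t.

(** The maximum over the vertices k generations below the vertex w of the sums of
    the increments on the path from w. *)
Fixpoint subtree_max (k : nat) (w : seq bool) (t : T) : R :=
  if k is k'.+1 then
    Num.max (word_step (rcons w false) t + subtree_max k' (rcons w false) t)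
            (word_step (rcons w true) t + subtree_max k' (rcons w true) t)
  else 0.

Lemma edge_word_inj : injective edge_word.
Proof. by move=> e f ef; do 2 apply: val_inj. Qed.

Lemma edge_word_size e : (0 < size (edge_word e) <= n)%N.
Proof. by rewrite (valP e) size_bseq. Qed.

Lemma word_edge w : (0 < size w <= n)%N -> exists e, edge_word e = w.
Proof.
by move=> /andP[w0 wn]; exists (Sub (Bseq wn) w0); rewrite /edge_word SubK.
Qed.

Lemma word_stepE e t : word_step (edge_word e) t = Y e t.
Proof.
by rewrite /word_step (big_pred1 e)// => f /=; rewrite (inj_eq edge_word_inj).
Qed.

Lemma subtree_max_le k w t x : reflect
  (forall u, size u = k -> \sum_(i < k) word_step (w ++ take i.+1 u) t <= x)
  (subtree_max k w t <= x).
Proof.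
elim: k w x => [|k IH] w x /=.
  apply: (iffP idP) => [x0 u _|/(_ [::] erefl)]; first by rewrite big_ord0.
  by rewrite big_ord0.
have E b u : \sum_(i < k.+1) word_step (w ++ take i.+1 (b :: u)) t =
    word_step (rcons w b) t + \sum_(i < k) word_step (rcons w b ++ take i.+1 u) t.
  rewrite big_ord_recl /= take0 cats1; congr (_ + _).
  by apply: eq_bigr => i _; rewrite cat_rcons.
have B b : reflect (forall u, size u = k ->
      \sum_(i < k.+1) word_step (w ++ take i.+1 (b :: u)) t <= x)
    (word_step (rcons w b) t + subtree_max k (rcons w b) t <= x).
  rewrite addrC -lerBrDr; apply: (iffP (IH _ _)) => H u uk; have := H u uk.
    by rewrite E lerBrDr addrC.
  by rewrite E lerBrDr addrC.
rewrite ge_max; apply: (iffP andP) => [[/B H0 /B H1] [|[] u]//= [uk]|H].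
- exact: H1.
- exact: H0.
by split; apply/B => u uk; apply: H; rewrite /= uk.
Qed.

(** The edges on the path to v are its nonempty prefixes, one of each length. *)
Lemma brwE (v : leaf n) t :
  brw Y v t = \sum_(i < n) word_step (take i.+1 v) t.
Proof.
have pn e : ((size (edge_word e)).-1 < n)%N.
  by have /andP[s0] := edge_word_size e; rewrite prednK.
pose p e := Ordinal (pn e).
rewrite /brw (partition_big p xpredT)//=; apply: eq_bigr => i _.
apply: eq_bigl => e; rewrite /on_path -/(edge_word e) prefixE.
have /andP[s0 sn] := edge_word_size e.
apply/andP/eqP => [[/eqP <- /eqP <-] /=|ev].
  by rewrite prednK// ; congr take; rewrite size_take size_tuple; case: ltngtP sn.
have sv : size (take i.+1 v) = i.+1 by rewrite size_takel// size_tuple.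
by split; [rewrite ev sv|apply/eqP/val_inj; rewrite /= ev sv].
Qed.

Lemma brw_max_le t x : (brw_max Y t <= x) = (subtree_max n [::] t <= x).
Proof.
apply/idP/subtree_max_le => [H u un|H].
  have un' : size u == n by rewrite un.
  rewrite -(brwE (Tuple un')); apply: le_trans H; exact: le_bigmax.
apply/bigmax_leP; split => [|v _]; rewrite brwE; apply: H; exact: size_tuple.
Qed.

End tree_recursion.

Section law_of_the_maximum.
Context d (T : measurableType d) (R : realType) (P : probability T R).
Variables (sigma : R) (n : nat) (Y : edge n -> {RV P >-> R}).
Hypothesis Y_iid : iid_centered_gaussian sigma Y.
Local Notation adapted := (adapted Y).
Local Notation word_step := (word_step Y).
Local Notation subtree_max := (subtree_max Y).

Definition edge_at (w : seq bool) : {set edge n} := [set e | edge_word e == w].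

Definition below (w : seq bool) : {set edge n} :=
  [set e | prefix w (edge_word e)].

Definition strictly_below (w : seq bool) : {set edge n} :=
  [set e | prefix w (edge_word e) && (size w < size (edge_word e))%N].

Lemma prefix_rcons_trans (w v : seq bool) b : prefix (rcons w b) v ->
  prefix w v && (size w < size v)%N.
Proof.
move=> /prefixP[u ->]; rewrite cat_rcons prefix_prefix size_cat /= -addSnnS.
by rewrite addSn ltnS leq_addr.
Qed.

Lemma adapted_word_step w : (0 < size w <= n)%N ->
  adapted (edge_at w) (word_step w).
Proof.
move=> /word_edge[e <-]; rewrite (_ : word_step _ = Y e).
  by apply: adaptedX; rewrite inE.
by apply/funext => t; rewrite word_stepE.
Qed.

Lemma adapted_below k w b : (size w + k < n)%N ->
  adapted (strictly_below (rcons w b)) (subtree_max k (rcons w b)) ->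
  adapted (below (rcons w b))
    (fun t => word_step (rcons w b) t + subtree_max k (rcons w b) t).
Proof.
move=> wk mS; have wn : (0 < size (rcons w b) <= n)%N.
  by rewrite size_rcons /= (leq_trans _ wk)// ltnS leq_addr.
apply: measurable_funD.
  apply: adaptedS (adapted_word_step wn) => e.
  by rewrite !inE => /eqP ->; exact: prefix_refl.
by apply: adaptedS mS => e; rewrite !inE => /andP[].
Qed.

Lemma adapted_subtree_max k w : (size w + k <= n)%N ->
  adapted (strictly_below w) (subtree_max k w).
Proof.
elim: k w => [|k IH] w wk; first exact: measurable_cst.
have H b : adapted (strictly_below w)
    (fun t => word_step (rcons w b) t + subtree_max k (rcons w b) t).
  have wk' : (size w + k < n)%N by rewrite -addnS.
  have := adapted_below wk' (IH (rcons w b) _); rewrite size_rcons addSn => /(_ wk').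
  by apply: adaptedS => e; rewrite !inE => /prefix_rcons_trans.
exact: measurable_maxr (H false) (H true).
Qed.

Lemma below_disjoint w e :
  e \in below (rcons w false) -> e \notin below (rcons w true).
Proof.
rewrite !inE => /prefixP[u ->].
by rewrite prefixE take_size_cat ?size_rcons// eqseq_rcons andbF.
Qed.

(** The increment on an edge is independent of what happens strictly below it. *)
Lemma probability_step_le k w b x : (size w + k < n)%N ->
  (forall y, P [set t | (subtree_max k (rcons w b) t <= y)%R] =
    (1 - max_tail sigma k y)%:E) ->
  P [set t | (word_step (rcons w b) t + subtree_max k (rcons w b) t <= x)%R] =
  (1 - gconv sigma (max_tail sigma k) x)%:E.
Proof.
move=> wk IH; have wn : (0 < size (rcons w b) <= n)%N.
  by rewrite size_rcons /= (leq_trans _ wk)// ltnS leq_addr.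
have wk' : (size (rcons w b) + k <= n)%N by rewrite size_rcons addSn.
have m1 := adapted_word_step wn; have m2 := adapted_subtree_max wk'.
rewrite (@probability_sum_le _ _ _ P sigma).
- under eq_integral do rewrite IH.
  have ci : gconv_integrable sigma (cst (1 : R)).
    by apply: (@gconv_integrable_bounded _ _ 1) => // y; rewrite normr1.
  have := gconvB x ci (max_tail_integrable sigma k); rewrite gconv_cst => <-.
  rewrite /gconv /Rintegral fineK//.
  have := gconv_integrableB ci (max_tail_integrable sigma k) x.
  exact: integrable_fin_num.
- exact: adapted_measurable m1.
- exact: adapted_measurable m2.
- have [e ew] := word_edge wn; move=> B mB.
  rewrite -(Y_iid.2 e B mB) /distribution /pushforward; congr (P _).
  by apply/seteqP; split => t /=; rewrite -ew word_stepE.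
- move=> B C mB mC; apply: (adapted_independent Y_iid.1 _ m1 m2) => // e.
  by rewrite !inE => /eqP ->; rewrite ltnn andbF.
Qed.

(** The two subtrees below w involve disjoint sets of edges. *)
Lemma subtree_max_law k w x : (size w + k <= n)%N ->
  P [set t | (subtree_max k w t <= x)%R] = (1 - max_tail sigma k x)%:E.
Proof.
elim: k w x => [|k IH] w x wk.
  rewrite /max_tail /=; case: ltP => x0; rewrite ?subrr ?subr0.
    by rewrite (_ : [set _ | _] = set0) ?measure0//; apply/seteqP; split.
  rewrite (_ : [set _ | _] = setT) ?probability_setT//.
  by apply/seteqP; split.
have wk' : (size w + k < n)%N by rewrite -addnS.
have wkb b : (size (rcons w b) + k <= n)%N by rewrite size_rcons addSn.
have Pb b := probability_step_le x wk' (fun y => IH (rcons w b) y (wkb b)).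
have mb b := adapted_below wk' (adapted_subtree_max (wkb b)).
have := adapted_independent Y_iid.1 (@below_disjoint w) (mb false) (mb true)
  (measurable_itv `]-oo, x]) (measurable_itv `]-oo, x]).
have E b : (fun t => word_step (rcons w b) t + subtree_max k (rcons w b) t) @^-1`
    `]-oo, x]%classic =
    [set t | (word_step (rcons w b) t + subtree_max k (rcons w b) t <= x)%R].
  by apply/seteqP; split => t /=; rewrite in_itv.
rewrite !E !Pb -EFinM => H.
have -> : 1 - max_tail sigma k.+1 x =
    (1 - gconv sigma (max_tail sigma k) x) * (1 - gconv sigma (max_tail sigma k) x).
  by rewrite max_tailS; ring.
rewrite -H; congr (P _); apply/seteqP.
by split => t /=; rewrite ge_max => /andP.
Qed.

Lemma measurable_brw_max : measurable_fun setT (brw_max Y).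
Proof.
rewrite (_ : brw_max Y = subtree_max n [::]).
  exact: adapted_measurable (@adapted_subtree_max n [::] (leqnn n)).
apply/funext => t; apply/eqP; rewrite eq_le brw_max_le lexx /=.
by rewrite -brw_max_le lexx.
Qed.

Lemma brw_max_law x :
  P [set t | (brw_max Y t <= x)%R] = (1 - max_tail sigma n x)%:E.
Proof.
rewrite -(@subtree_max_law n [::])//; congr (P _).
by apply/seteqP; split => t /=; rewrite brw_max_le.
Qed.
End law_of_the_maximum.

(** * The limit in probability *)

Lemma near_le_ln (R : realType) (K : R) : \forall n \near \oo, K <= ln n%:R :> R.
Proof.
exists (Num.truncn (expR K)).+1 => // n /= Kn.
have /truncn_itv/andP[_ K1] := expR_ge0 K.
have Kn' : expR K <= n%:R by rewrite (le_trans (ltW K1))// ler_nat.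
by rewrite -(expRK K) ler_ln// posrE ?expR_gt0// (lt_le_trans _ Kn') ?expR_gt0.
Qed.


Theorem theorem4 (R : realType) (sigma : R) (d : nat -> measure_display)
    (T : forall n : nat, measurableType (d n))
    (P : forall n : nat, probability (T n) R)
    (Y : forall n : nat, edge n -> {RV (P n) >-> R})
    (sigma_gt0 : 0 < sigma)
    (Y_iid : forall n : nat, (0 < n)%N ->
      iid_centered_gaussian sigma (Y n)) :
  let c := Num.sqrt (2 * ln 2) * sigma in
  cvg_in_probability P
    (fun n t => (brw_max (Y n) t - c * n%:R) / ln n%:R)
    (- (3 / 2 * (sigma ^+ 2 / c))).
Proof.
move=> c.
pose theta := Num.sqrt (2 * ln 2) / sigma.
have ln2 : 0 < ln 2 :> R by rewrite ln_gt0// ltr1n.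
have sq0 : 0 < Num.sqrt (2 * ln 2) :> R by rewrite sqrtr_gt0 mulr_gt0.
have theta_gt0 : 0 < theta by rewrite divr_gt0.
have theta_crit : expR (theta ^+ 2 * sigma ^+ 2 / 2) = 2.
  rewrite /theta -exprMn divfK ?gt_eqF// sqr_sqrtr ?mulr_ge0 ?ltW//.
  by rewrite mulrAC divff// mul1r lnK// posrE.
have cE : c = theta * sigma ^+ 2 by rewrite /c /theta; field; rewrite gt_eqF.
have -> : 3 / 2 * (sigma ^+ 2 / c) = 3 / (2 * theta).
  by rewrite cE; field; rewrite !gt_eqF.
move=> eps eps0.
have [K HK] := max_tail_upper sigma_gt0 theta_gt0 theta_crit eps0.
set A := (fun n => _).
suff small e : 0 < e -> \forall n \near \oo, (A n <= e%:E)%E.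
  have A0 n : (0 <= A n)%E by exact: measure_ge0.
  have Afin : \forall n \near \oo, A n \is a fin_num.
    near=> n; rewrite ge0_fin_numE// (@le_lt_trans _ _ 1%:E) ?ltry//.
    by near: n; exact: small.
  apply: cvg_EFin => //; apply/cvgrPdist_le => e e0.
  near=> n; rewrite sub0r normrN ger0_norm /= ?fine_ge0// -lee_fin fineK.
    by near: n; exact: small.
  by near: n.
move=> e0.
pose del := Num.min (e / 2) (1 / 2).
have del_e : del <= e / 2 by rewrite ge_min lexx.
have del_1 : del <= 1 / 2 by rewrite ge_min lexx orbT.
have del0 : 0 < del by rewrite lt_min !divr_gt0.
have del01 : 0 < del < 1 by rewrite del0; lra.
have [K' HK'] := max_tail_lower sigma_gt0 theta_gt0 theta_crit eps0 del01.
near=> n.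
have nK : K <= ln n%:R by near: n; exact: near_le_ln.
have nK' : K' <= ln n%:R by near: n; exact: near_le_ln.
have n1 : 1 <= ln n%:R :> R by near: n; exact: near_le_ln.
have nKe : K / (e / 2) <= ln n%:R by near: n; exact: near_le_ln.
have t0 : 0 < ln n%:R :> R by rewrite (lt_le_trans ltr01).
have n0 : (0 < n)%N.
  by rewrite lt0n; apply/eqP => n0; move: t0; rewrite n0 ln0// ltxx.
have law x := brw_max_law (Y_iid n n0) x.
have mM := measurable_brw_max (Y n).
have mle x : measurable [set t | brw_max (Y n) t <= x].
  rewrite [X in measurable X](_ : _ = brw_max (Y n) @^-1` `]-oo, x]%classic).
    by rewrite -[X in measurable X]setTI; exact: mM.
  by apply/seteqP; split => t /=; rewrite in_itv.
pose x1 := theta * sigma ^+ 2 * n%:R + (eps - 3 / (2 * theta)) * ln n%:R.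
pose x2 := theta * sigma ^+ 2 * n%:R - (3 / (2 * theta) + eps) * ln n%:R.
rewrite /A; set B := [set t | _].
have mB : measurable B.
  rewrite [B](_ : _ = (fun t => `|(brw_max (Y n) t - c * n%:R) / ln n%:R
      - - (3 / (2 * theta))|) @^-1` `]eps, +oo[%classic); last first.
    by apply/seteqP; split => t /=; rewrite in_itv/= andbT.
  rewrite -[X in measurable X]setTI; apply: measurableT_comp => //.
  apply: measurable_funB => //; apply: measurable_funM => //.
  exact: measurable_funB.
have sub : B `<=`
    ~` [set t | brw_max (Y n) t <= x1] `|` [set t | brw_max (Y n) t <= x2].
  move=> t; rewrite /B /= opprK ltr_normr => /orP[H|H]; [left|right].
    move=> /= Mx; move: H; apply/negP; rewrite -leNgt -lerBrDr ler_pdivrMr//.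
    by rewrite lerBlDr addrC cE.
  have {}H : (brw_max (Y n) t - c * n%:R) / ln n%:R < - (3 / (2 * theta) + eps).
    by move: H; set Q := _ / ln _; set w := 3 / _; clear; lra.
  rewrite ltr_pdivrMr// mulNr ltrBlDl cE in H.
  exact: ltW.
apply: (@le_trans _ _ (P n (~` [set t | (brw_max (Y n) t <= x1)%R]) +
    P n [set t | (brw_max (Y n) t <= x2)%R])%E).
  apply: (le_trans (le_measure _ _ _ sub)); rewrite ?inE//.
    by apply: measurableU => //; exact: measurableC.
  by apply: measureU2 => //; exact: measurableC.
rewrite probability_setC// !law -EFinB -EFinD lee_fin.
have h1 : max_tail sigma n x1 <= e / 2.
  apply: (le_trans (HK n nK)); rewrite ler_pdivrMr// mulrC -ler_pdivrMr//.
  by rewrite divr_gt0.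
have h2 := HK' n nK'; rewrite -/x2 in h2; lra.
Unshelve. all: by end_near.
Qed.
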